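(* Let $\alpha \in (0,\pi]$ and $\beta \in [0,\pi)$, and assume that if $(\alpha,\beta) \in [\pi/4,\pi]\times[0,3\pi/4]$ then $\cos\alpha\cos\beta - \sin(\alpha-\beta) \neq 0$. Let $p$ and $\tilde p$ be two density functions on $[0,1]$, let $\lambda_0 = \lambda_0(p,\alpha,\beta)$ and $\tilde\lambda_0 = \lambda_0(\tilde p,\alpha,\beta)$ be the lowest eigenvalues of $S(p,\alpha,\beta)$ and $S(\tilde p,\alpha,\beta)$, and put $\check p = \tilde p/p$. If $$\lambda_0 = \tilde\lambda_0 \max_{x\in[0,1]} \check p(x) \qquad\text{or}\qquad \lambda_0 = \tilde\lambda_0 \min_{x\in[0,1]} \check p(x),$$ then $p(x) = \dfrac{\tilde\lambda_0}{\lambda_0}\,\tilde p(x)$ on $[0,1]$.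
   Context: A density function is a real-valued, piecewise continuous, positive function on $[0,1]$ that is bounded away from $0$. For a density function $p$ and $\alpha\in(0,\pi]$, $\beta\in[0,\pi)$, $S(p,\alpha,\beta)$ denotes the self-adjoint operator generated by the boundary value problem (vibrating string equation) $$-u'' = \lambda p(x) u,\quad x\in(0,1),\ \lambda\in\mathbb{C},$$ $$u(0)\cos\alpha + u'(0)\sin\alpha = 0,\qquad u(1)\cos\beta + u'(1)\sin\beta = 0.$$ Its spectrum is discrete and consists of real, simple eigenvalues, denoted $\lambda_0(p,\alpha,\beta) < \lambda_1(p,\alpha,\beta) < \cdots < \lambda_n(p,\alpha,\beta) < \cdots$.
   Formalization: Equality p = (λ̃₀/λ₀) p̃ is asserted at every x in [0,1] where p and p̃ are both continuous, not at jump points: p = 1 and p̃ = 1 except p̃(1/2) = 2 meet the min hypothesis but differ at 1/2. Max and min are read as sup and inf. *)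

(* Defs.v *)
(* Stdlib reals with Coquelicot. *)
From Stdlib Require Import Reals List.
From Coquelicot Require Import Coquelicot.
Open Scope R_scope.

Definition I01 (x : R) : Prop := 0 <= x <= 1.

(* Continuity at [x] of the restriction of [f] to [0,1]; values of [f] outside
   [0,1] are irrelevant. *)
Definition continuous01 {V : UniformSpace} (f : R -> V) (x : R) : Prop :=
  filterlim f (within I01 (locally x)) (locally (f x)).

(* Derivative at [x] of the restriction of [f] to [0,1]: two-sided inside,
   one-sided at 0 and 1. *)
Definition is_derive01 (f : R -> C) (x : R) (l : C) : Prop :=
  filterdiff (K := R_AbsRing) (U := R_NormedModule) (V := C_R_NormedModule)
    f (within I01 (locally x)) (fun h : R => scal h l).

(* Finitely many discontinuities, each with finite one-sided limits; the values
   at the discontinuities themselves are arbitrary. *)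
Definition piecewise_continuous01 (f : R -> R) : Prop :=
  (exists s : list R, forall x, I01 x -> ~ In x s -> continuous01 f x) /\
  (forall x, 0 <= x < 1 -> exists l : R, filterlim f (at_right x) (locally l)) /\
  (forall x, 0 < x <= 1 -> exists l : R, filterlim f (at_left x) (locally l)).

Definition density (p : R -> R) : Prop :=
  piecewise_continuous01 p /\
  (forall x, I01 x -> 0 < p x) /\
  (exists c : R, 0 < c /\ forall x, I01 x -> c <= p x).

(* [u] solves the boundary value problem with spectral parameter [lam].
   Since p is piecewise continuous, a function in the domain of S(p,a,b)
   (u and u' absolutely continuous) with S u = lam u is exactly a C^1 function
   on [0,1] satisfying the equation at every continuity point of p. *)
Definition bvp_solution (p : R -> R) (a b : R) (lam : C) (u : R -> C) : Prop :=
  exists du : R -> C,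
    (forall x, I01 x -> is_derive01 u x (du x)) /\
    (forall x, I01 x -> continuous01 (V := C_UniformSpace) du x) /\
    (forall x, 0 < x < 1 -> continuous01 p x ->
       exists d2u : C,
         is_derive01 du x d2u /\ (- d2u = lam * RtoC (p x) * u x)%C) /\
    (u 0 * RtoC (cos a) + du 0 * RtoC (sin a) = 0)%C /\
    (u 1 * RtoC (cos b) + du 1 * RtoC (sin b) = 0)%C.

Definition eigenvalue (p : R -> R) (a b : R) (lam : C) : Prop :=
  exists u : R -> C,
    bvp_solution p a b lam u /\ exists x, I01 x /\ u x <> RtoC 0.

(* All eigenvalues are real, so the lowest one is the least real eigenvalue. *)
Definition lowest_eigenvalue (p : R -> R) (a b l : R) : Prop :=
  eigenvalue p a b (RtoC l) /\
  forall mu : R, eigenvalue p a b (RtoC mu) -> l <= mu.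

(* Maximum and minimum over [0,1], read as supremum and infimum since a
   piecewise continuous function need not attain its bounds. [real] discards
   infinite values, which do not occur for quotients of densities. *)
Definition max01 (f : R -> R) : R :=
  real (Lub_Rbar (fun y => exists x, I01 x /\ y = f x)).

Definition min01 (f : R -> R) : R :=
  real (Glb_Rbar (fun y => exists x, I01 x /\ y = f x)).

(* Main.v *)
Require Import Defs.
From Stdlib Require Import Reals List Lra Lia Classical.
From Coquelicot Require Import Coquelicot.
Open Scope R_scope.

(** Write [M] for the maximum (or minimum) of [pt / p]. If [l0 = lt0 * M], then
    [r = l0 * p - lt0 * pt = lt0 * (M * p - pt)] has constant sign on [[0,1]].
    Let [y] and [yt] be real eigenfunctions for [l0] and [lt0]. Their Wronskian
    [W = y * yt' - y' * yt] has derivative [r * y * yt], and it vanishes at 0 and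
    at 1 because both functions satisfy the same boundary conditions. If [y] and
    [yt] are positive on the open interval, [W] is therefore monotone with equal
    end values, hence constant, so [r * y * yt] vanishes and with it [r], at every
    point where both densities are continuous. Continuity carries this over to
    the end points.

    What remains is that a lowest eigenfunction has no zero inside the interval
    ([first_shot_positive]) and that [l0] is not zero
    ([lowest_eigenvalue_nonzero]).

    For the first point, let [shot lam] solve the equation with the initial
    data [sin a], [- cos a], and let [shot_defect lam] be the quantity whose
    vanishing is the boundary condition at 1; its real zeros are exactly the real
    eigenvalues. For very negative [lam] the function [shot lam] is positive on
    [(0,1]] and grows so fast that [shot_defect lam > 0]
    ([strongly_negative_parameter]). Suppose [shot l0] is negative somewhere, and
    let [L] be the infimum of the parameters up to [l0] for which [shot] takes a
    negative value. By continuity [shot L] is nonnegative, so [L < l0], and it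
    has no interior zero, since such a zero would be double. If [shot L 1] were
    positive, positivity would persist for parameters slightly above [L]
    ([positivity_stable]). Hence [shot L 1 = 0], the slope there is at most 0, and
    [shot_defect L <= 0]. The intermediate value theorem then yields an eigenvalue
    not exceeding [L], which is below [l0].

    For the second point, when [l0 = 0] the eigenfunction is the linear function
    [sin a - cos a * x]; its positivity forces [a] and [b] into the range where
    the hypothesis on the angles excludes the eigenvalue 0.

    Solutions are produced by a Picard series ([ivp_solution]); uniqueness and
    continuity in [lam] come from one Gronwall estimate
    ([solution_dependence]). *)

(** * Continuity and monotonicity on the unit interval *)

(** Composing with [clamp] turns data known only on [[0,1]] into functions on
    the whole line, so that ordinary continuity can replace one-sided continuity
    at the end points. *)
Definition clamp (x : R) : R := Rmax 0 (Rmin 1 x).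

Lemma clamp_I01 x : I01 (clamp x).
Proof. unfold I01, clamp, Rmax, Rmin. repeat destruct Rle_dec; lra. Qed.

Lemma clamp_id x : I01 x -> clamp x = x.
Proof. unfold I01, clamp, Rmax, Rmin. intros. repeat destruct Rle_dec; lra. Qed.

Lemma clamp_lipschitz x y : Rabs (clamp x - clamp y) <= Rabs (x - y).
Proof.
  unfold clamp, Rmax, Rmin.
  repeat destruct Rle_dec; unfold Rabs; repeat destruct Rcase_abs; lra.
Qed.

Lemma lipschitz_continuous (f : R -> R) (L : R) :
  (forall x y, Rabs (f x - f y) <= L * Rabs (x - y)) ->
  forall x, continuous f x.
Proof.
  intros Hf x.
  assert (HL : 0 <= L).
  { pose proof (Hf 1 0) as H. replace (Rabs (1 - 0)) with 1 in H by
      (rewrite Rabs_pos_eq; lra). pose proof (Rabs_pos (f 1 - f 0)); lra. }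
  apply filterlim_locally. intros eps.
  assert (Hd : 0 < eps / (L + 1)).
  { apply Rdiv_lt_0_compat; [apply cond_pos | lra]. }
  exists (mkposreal _ Hd). intros y Hy.
  change (Rabs (y - x) < eps / (L + 1)) in Hy.
  change (Rabs (f y - f x) < eps).
  apply Rle_lt_trans with (1 := Hf y x).
  apply Rle_lt_trans with ((L + 1) * Rabs (y - x)).
  { pose proof (Rabs_pos (y - x)). nra. }
  apply Rmult_lt_reg_r with (/ (L + 1)). apply Rinv_0_lt_compat; lra.
  replace ((L + 1) * Rabs (y - x) * / (L + 1)) with (Rabs (y - x)) by (field; lra).
  exact Hy.
Qed.

Lemma clamp_continuous x : continuous clamp x.
Proof.
  apply (lipschitz_continuous clamp 1). intros u v.
  pose proof (clamp_lipschitz u v). lra.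
Qed.

Lemma locally_open_interval (a b x : R) :
  a < x < b -> locally x (fun y : R => a < y < b).
Proof.
  intros H.
  apply filter_and; [apply (open_gt a) | apply (open_lt b)]; lra.
Qed.

Lemma continuous_of_approx (f : R -> R) :
  (forall eps : posreal, exists g : R -> R,
     (forall x, continuous g x) /\ forall x, Rabs (f x - g x) <= eps) ->
  forall x, continuous f x.
Proof.
  intros Hf x. apply filterlim_locally. intros eps.
  assert (He : 0 < eps / 4) by (pose proof (cond_pos eps); lra).
  destruct (Hf (mkposreal _ He)) as [g [Hg Hfg]]. simpl in Hfg.
  pose proof (proj1 (filterlim_locally _ _) (Hg x) (mkposreal _ He)) as H.
  apply filter_imp with (2 := H). intros y Hy.
  change (Rabs (g y - g x) < eps / 4) in Hy.
  change (Rabs (f y - f x) < eps).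
  pose proof (Hfg x) as Hx. pose proof (Hfg y) as Hy'.
  pose proof (cond_pos eps).
  apply Rabs_def2 in Hy. apply Rabs_le_between in Hx. apply Rabs_le_between in Hy'.
  apply Rabs_def1; lra.
Qed.

Lemma continuous_bounded01 (f : R -> R) :
  (forall x, continuous f x) -> exists M, 0 <= M /\ forall x, I01 x -> Rabs (f x) <= M.
Proof.
  intros Hf.
  destruct (continuity_ab_maj (fun x => Rabs (f x)) 0 1) as [m [Hm _]]; [lra| |].
  { intros c _. apply continuity_pt_filterlim. apply continuous_Rabs_comp, Hf. }
  exists (Rabs (f m)). split; [apply Rabs_pos | exact Hm].
Qed.

Lemma mean_value (f df : R -> R) (a b : R) :
  a < b -> (forall x, continuous f x) ->
  (forall x, a < x < b -> is_derive f x (df x)) ->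
  exists x, a < x < b /\ f b - f a = df x * (b - a).
Proof.
  intros Hab Hc Hd.
  assert (prf : forall x, a < x < b -> derivable_pt f x).
  { intros x Hx. exists (df x). apply is_derive_Reals, Hd, Hx. }
  destruct (MVT f id a b prf (fun x _ => derivable_pt_id x)) as [x [Hx He]].
  - exact Hab.
  - intros x _. apply continuity_pt_filterlim, Hc.
  - intros x _. apply derivable_continuous_pt, derivable_pt_id.
  - exists x. split; [exact Hx|].
    rewrite derive_pt_id, Derive_Reals in He.
    rewrite (is_derive_unique _ _ _ (Hd x Hx)) in He. unfold id in He. lra.
Qed.

(** The string equation holds only where the density is continuous, so
    monotonicity has to be read off from derivatives that are known outside a
    finite set. Splitting the interval at the exceptional points reduces this to
    the mean value theorem. *)
Lemma nondecreasing_off_finite (s : list R) (f df : R -> R) :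
  (forall x, continuous f x) ->
  forall a b : R, a <= b ->
  (forall x, a < x < b -> ~ In x s -> is_derive f x (df x) /\ 0 <= df x) ->
  f a <= f b.
Proof.
  intros Hc. induction s as [|c s IH]; intros a b Hab Hd.
  - destruct (Req_dec a b) as [->|Hne]; [lra|].
    destruct (mean_value f df a b) as [x [Hx He]]; [lra | exact Hc | |].
    + intros x Hx. apply Hd; auto.
    + destruct (Hd x Hx) as [_ Hpos]; [auto|]. nra.
  - assert (Hsub : forall a' b', a <= a' -> b' <= b -> a' <= b' ->
              ~ a' < c < b' -> f a' <= f b').
    { intros a' b' Ha Hb Hab' Hncb. apply IH; [lra|].
      intros x Hx Hns. apply Hd; [lra|]. intros [->|Hin]; [lra | auto]. }
    destruct (Rlt_dec a c); [destruct (Rlt_dec c b)|].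
    + apply Rle_trans with (f c); apply Hsub; lra.
    + apply Hsub; lra.
    + apply Hsub; lra.
Qed.

(** On an interval without exceptional points, the one-sided limits at the ends
    allow the integrand to be replaced by a function continuous everywhere; the
    general case follows by splitting at the exceptional points. *)
Lemma ex_RInt_piecewise (s : list R) (f : R -> R) :
  forall a b : R, a <= b ->
  (forall x, a < x < b -> ~ In x s -> continuous f x) ->
  (forall x, a <= x < b -> exists l : R, filterlim f (at_right x) (locally l)) ->
  (forall x, a < x <= b -> exists l : R, filterlim f (at_left x) (locally l)) ->
  ex_RInt f a b.
Proof.
  induction s as [|c s IH]; intros a b Hab Hc Hr Hl.
  - destruct (Req_dec a b) as [->|Hne]; [apply ex_RInt_point|].
    destruct (Hr a) as [la Hla]; [lra|]. destruct (Hl b) as [lb Hlb]; [lra|].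
    destruct (C0_extension_lt f la lb a b) as [g [Hg [Hgf _]]]; auto; [lra| |].
    { intros x Hx. apply Hc; auto. }
    apply ex_RInt_ext with g.
    + rewrite Rmin_left, Rmax_right by lra. exact Hgf.
    + apply (ex_RInt_continuous (V := R_CompleteNormedModule)).
      intros z _. apply Hg.
  - assert (Hsub : forall a' b', a <= a' -> b' <= b -> a' <= b' ->
              ~ a' < c < b' -> ex_RInt f a' b').
    { intros a' b' Ha Hb Hab' Hncb. apply IH; [lra| | |].
      - intros x Hx Hns. apply Hc; [lra|]. intros [->|Hin]; [lra | auto].
      - intros x Hx. apply Hr; lra.
      - intros x Hx. apply Hl; lra. }
    destruct (Rlt_dec a c); [destruct (Rlt_dec c b)|].
    + apply ex_RInt_Chasles with c; apply Hsub; lra.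
    + apply Hsub; lra.
    + apply Hsub; lra.
Qed.

Lemma continuous01_interior (p : R -> R) x :
  0 < x < 1 -> (continuous01 p x <-> continuous p x).
Proof.
  intros Hx. unfold continuous01, continuous. split; intros H P HP.
  - specialize (H P HP). unfold filtermap, within in *.
    pose proof (locally_open_interval 0 1 x Hx) as Ho.
    generalize (filter_and _ _ H Ho). apply filter_imp.
    intros y [H1 H2]. apply H1. unfold I01; lra.
  - apply (filter_le_within (F := locally x) I01), H, HP.
Qed.

Lemma continuous_ex_RInt (f : R -> R) x y :
  (forall x, continuous f x) -> ex_RInt f x y.
Proof.
  intros Hf. apply (ex_RInt_continuous (V := R_CompleteNormedModule)). intros; apply Hf.
Qed.

Lemma exp_le_mono x y : x <= y -> exp x <= exp y.
Proof.
  intros H. destruct (Rle_lt_or_eq_dec _ _ H) as [Hl| ->]; [|lra].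
  left; apply exp_increasing, Hl.
Qed.

Lemma half_pow_small M (eps : R) : 0 <= M -> 0 < eps -> exists n, M * (1 / 2) ^ n <= eps.
Proof.
  intros HM He.
  destruct (pow_lt_1_zero (1 / 2)) with (y := eps / (M + 1)) as [n Hn].
  - rewrite Rabs_pos_eq; lra.
  - apply Rdiv_lt_0_compat; lra.
  - exists n. specialize (Hn n (le_n n)).
    rewrite Rabs_pos_eq in Hn by (apply pow_le; lra).
    assert (H : (1 / 2) ^ n * (M + 1) < eps).
    { apply Rmult_lt_reg_r with (/ (M + 1)); [apply Rinv_0_lt_compat; lra|].
      rewrite Rmult_assoc, Rinv_r, Rmult_1_r by lra. exact Hn. }
    assert (0 <= (1 / 2) ^ n) by (apply pow_le; lra). nra.
Qed.

Lemma continuous_of_is_derive (f : R -> R) x l : is_derive f x l -> continuous f x.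
Proof. intros H. apply (ex_derive_continuous (V := R_NormedModule)). now exists l. Qed.

Lemma continuous_Rmult (f g : R -> R) x :
  continuous f x -> continuous g x -> continuous (fun t => f t * g t) x.
Proof. apply (continuous_mult (K := R_AbsRing)). Qed.

Lemma continuous_Rplus (f g : R -> R) x :
  continuous f x -> continuous g x -> continuous (fun t => f t + g t) x.
Proof. apply (continuous_plus (V := R_NormedModule)). Qed.

Lemma continuous_Rminus (f g : R -> R) x :
  continuous f x -> continuous g x -> continuous (fun t => f t - g t) x.
Proof. apply (continuous_minus (V := R_NormedModule)). Qed.

Lemma continuous_Ropp (f : R -> R) x :
  continuous f x -> continuous (fun t => - f t) x.
Proof. apply (continuous_opp (V := R_NormedModule)). Qed.

Lemma continuous_exp_comp (f : R -> R) x :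
  continuous f x -> continuous (fun t => exp (f t)) x.
Proof.
  intros H. apply (continuous_comp f exp); [exact H|].
  apply continuous_of_is_derive with (exp (f x)). apply is_derive_Reals, derivable_pt_lim_exp.
Qed.

Ltac cont := repeat lazymatch goal with
  | |- continuous (fun _ => ?k) ?x => apply (continuous_const k x)
  | |- continuous (fun t => t) ?x => apply (continuous_id x)
  | |- continuous (fun t => @?f t + @?g t) ?x => apply (continuous_Rplus f g x)
  | |- continuous (fun t => @?f t - @?g t) ?x => apply (continuous_Rminus f g x)
  | |- continuous (fun t => @?f t * @?g t) ?x => apply (continuous_Rmult f g x)
  | |- continuous (fun t => - @?f t) ?x => apply (continuous_Ropp f x)
  | |- continuous (fun t => exp (@?f t)) ?x => apply (continuous_exp_comp f x)
  | H : forall x, continuous ?f x |- continuous ?f ?x => apply (H x)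
  | H : forall x, continuous ?f x |- continuous (fun t => ?f t) ?x => apply (H x)
  end.

(** Differentiates an expression in which the derivatives of the abstract
    functions are supplied by [is_derive] hypotheses. *)
Ltac derive_by_known :=
  auto_derive;
  [ repeat split; try (eexists; eassumption)
  | repeat match goal with
    | H : is_derive ?f ?x ?l |- _ =>
        let E := fresh in
        assert (E : Derive (fun t => f t) x = l) by exact (is_derive_unique f x l H);
        rewrite ?E; clear E H
    end ].

Lemma continuous_positive_min (f : R -> R) (a b : R) :
  a <= b -> (forall x, continuous f x) -> (forall x, a <= x <= b -> 0 < f x) ->
  exists m, 0 < m /\ forall x, a <= x <= b -> m <= f x.
Proof.
  intros Hab Hc Hpos.
  destruct (continuity_ab_min f a b Hab) as [m [Hm Hin]].
  { intros x _. apply continuity_pt_filterlim, Hc. }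
  exists (f m). split; [apply Hpos, Hin | exact Hm].
Qed.

Lemma continuous_pos_near (f : R -> R) (x : R) :
  continuous f x -> 0 < f x ->
  exists d, 0 < d /\ forall t, Rabs (t - x) < d -> f x / 2 < f t.
Proof.
  intros Hc Hpos. assert (He : 0 < f x / 2) by lra.
  destruct (proj1 (filterlim_locally _ _) Hc (mkposreal _ He)) as [d Hd].
  exists d. split; [apply cond_pos|]. intros t Ht.
  specialize (Hd t Ht). change (Rabs (f t - f x) < f x / 2) in Hd.
  apply Rabs_def2 in Hd. lra.
Qed.

Lemma slope_zero_at_interior_min (f : R -> R) (x l : R) :
  0 < x < 1 -> is_derive f x l -> (forall t, I01 t -> f x <= f t) -> l = 0.
Proof.
  intros Hx Hd Hmin.
  assert (pr : derivable_pt f x) by (exists l; apply is_derive_Reals, Hd).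
  rewrite <- (deriv_minimum f 0 1 x pr); [| lra | lra |].
  - rewrite Derive_Reals. symmetry. apply is_derive_unique, Hd.
  - intros t H1 H2. apply Hmin. unfold I01; lra.
Qed.

Lemma locally_lipschitz_continuous (f : R -> R) (x L : R) :
  (forall t, Rabs (t - x) <= 1 -> Rabs (f t - f x) <= L * Rabs (t - x)) ->
  continuous f x.
Proof.
  intros H. apply filterlim_locally. intros eps.
  set (M := Rabs L + 1). pose proof (Rabs_pos L). pose proof (cond_pos eps).
  assert (Hd : 0 < Rmin 1 (eps / M)).
  { apply Rmin_glb_lt; [lra | apply Rdiv_lt_0_compat; unfold M; lra]. }
  exists (mkposreal _ Hd). intros t Ht.
  change (Rabs (t - x) < Rmin 1 (eps / M)) in Ht.
  pose proof (Rmin_l 1 (eps / M)). pose proof (Rmin_r 1 (eps / M)).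
  change (Rabs (f t - f x) < eps).
  apply Rle_lt_trans with (L * Rabs (t - x)); [apply H; lra|].
  apply Rle_lt_trans with (M * Rabs (t - x)).
  { pose proof (Rabs_pos (t - x)). pose proof (Rle_abs L). unfold M. nra. }
  replace (pos eps) with (M * (eps / M)) by (field; unfold M; lra).
  apply Rmult_lt_compat_l; [unfold M|]; lra.
Qed.

Lemma RInt_exp_bound (g : R -> R) (N K x : R) :
  0 < K -> 0 <= N -> 0 <= x -> ex_RInt g 0 x ->
  (forall t, 0 <= t <= x -> Rabs (g t) <= N * exp (K * t)) ->
  Rabs (RInt g 0 x) <= N / K * exp (K * x).
Proof.
  intros HK HN Hx Hg Hb.
  assert (HI : is_RInt (fun t => N * exp (K * t)) 0 x
                 (N / K * exp (K * x) - N / K * exp (K * 0))).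
  { apply (is_RInt_derive (V := R_CompleteNormedModule) (fun t => N / K * exp (K * t))).
    - intros t _. auto_derive; [exact I|]. field. lra.
    - intros t _. cont. }
  apply Rle_trans with (N / K * exp (K * x) - N / K * exp (K * 0)).
  - apply (norm_RInt_le (V := R_NormedModule) g (fun t => N * exp (K * t)) 0 x);
      [exact Hx | exact Hb | apply (RInt_correct (V := R_CompleteNormedModule)), Hg | exact HI].
  - assert (0 <= N / K * exp (K * 0)); [|lra].
    apply Rmult_le_pos; [apply Rdiv_le_0_compat; lra | left; apply exp_pos].
Qed.

(** The integrand need not be integrable beyond [[0,1]], so continuity is
    obtained from a Lipschitz bound rather than from differentiation at the ends. *)
Lemma continuous_RInt_clamp (g : R -> R) (M : R) :
  (forall x y, I01 x -> I01 y -> x <= y -> ex_RInt g x y) ->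
  (forall x, I01 x -> Rabs (g x) <= M) ->
  forall x, continuous (fun x => RInt g 0 (clamp x)) x.
Proof.
  intros Hg HM.
  assert (H0 : I01 0) by (unfold I01; lra).
  assert (HM0 : 0 <= M) by (apply Rle_trans with (2 := HM 0 H0), Rabs_pos).
  assert (Hle : forall u v, I01 u -> I01 v -> u <= v ->
                 Rabs (RInt g 0 v - RInt g 0 u) <= M * (v - u)).
  { intros u v Hu Hv Huv.
    assert (Hu0 : ex_RInt g 0 u) by (apply Hg; [exact H0 | exact Hu | apply Hu]).
    rewrite <- (RInt_Chasles (V := R_CompleteNormedModule) g 0 u v) by (auto; apply Hg; auto).
    replace (plus (RInt g 0 u) (RInt g u v) - RInt g 0 u) with (RInt g u v)
      by (simpl; unfold plus; simpl; lra).
    rewrite Rmult_comm.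
    apply (norm_RInt_le_const (V := R_NormedModule) g u v); [exact Huv | |].
    - intros t Ht. apply HM. unfold I01 in *; lra.
    - apply (RInt_correct (V := R_CompleteNormedModule)), Hg; auto. }
  apply (lipschitz_continuous _ M). intros x y.
  apply Rle_trans with (M * Rabs (clamp x - clamp y));
    [|apply Rmult_le_compat_l; [exact HM0 | apply clamp_lipschitz]].
  pose proof (clamp_I01 x). pose proof (clamp_I01 y).
  destruct (Rle_dec (clamp x) (clamp y)).
  - rewrite Rabs_minus_sym, (Rabs_minus_sym (clamp x)), (Rabs_pos_eq (clamp y - clamp x)) by lra.
    apply Hle; auto.
  - rewrite (Rabs_pos_eq (clamp x - clamp y)) by lra. apply Hle; auto; lra.
Qed.

(** * Densities and solutions of the string equation *)

(** The consequences of [density] that matter for the differential equation: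
    two-sided bounds, continuity outside the finite list [s], and integrability
    against continuous functions. *)
Definition weight (p : R -> R) (s : list R) (c B : R) : Prop :=
  0 < c /\
  (forall x, I01 x -> c <= p x <= B) /\
  (forall x, 0 < x < 1 -> ~ In x s -> continuous p x) /\
  (forall f : R -> R, (forall x, continuous f x) ->
     forall x y, I01 x -> I01 y -> x <= y -> ex_RInt (fun t => p t * f t) x y).

Lemma filterlim_mult_continuous (F : (R -> Prop) -> Prop) {FF : Filter F}
  (p f : R -> R) (x l : R) :
  filter_le F (locally x) -> continuous f x -> filterlim p F (locally l) ->
  filterlim (fun t => p t * f t) F (locally (l * f x)).
Proof.
  intros HF Hf Hp.
  apply (filterlim_comp_2 (G := locally l) (H := locally (f x)) p f Rmult).
  - exact Hp.
  - apply (filterlim_filter_le_1 (F := locally x)); [exact HF | exact Hf].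
  - apply (filterlim_mult (K := R_AbsRing)).
Qed.

Lemma density_weight (p : R -> R) :
  density p -> exists s c B, weight p s c B.
Proof.
  intros [[[s Hs] [Hr Hl]] [_ [c [Hc Hcp]]]].
  assert (Hint : forall f : R -> R, (forall x, continuous f x) ->
     forall x y, I01 x -> I01 y -> x <= y -> ex_RInt (fun t => p t * f t) x y).
  { intros f Hf x y [Hx1 Hx2] [Hy1 Hy2] Hxy. apply ex_RInt_piecewise with s; [lra| | |].
    - intros t Ht Hns. apply (continuous_mult (K := R_AbsRing)); [|apply Hf].
      apply continuous01_interior; [lra|]. apply Hs; [unfold I01; lra | exact Hns].
    - intros t Ht. destruct (Hr t) as [l Hlim]; [lra|].
      exists (l * f t). apply filterlim_mult_continuous; [typeclasses eauto | | apply Hf | exact Hlim].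
      apply (filter_le_within (F := locally t)).
    - intros t Ht. destruct (Hl t) as [l Hlim]; [lra|].
      exists (l * f t). apply filterlim_mult_continuous; [typeclasses eauto | | apply Hf | exact Hlim].
      apply (filter_le_within (F := locally t)). }
  assert (H1 : ex_RInt (fun t => p t * 1) 0 1).
  { apply (Hint (fun _ => 1)); unfold I01; try lra.
    intros x. apply continuous_const. }
  apply ex_RInt_ub in H1. destruct H1 as [B HB].
  exists s, c, B. split; [exact Hc | split; [|split; [|exact Hint]]].
  - intros x Hx. split; [apply Hcp; exact Hx|]. destruct Hx as [Hx1 Hx2].
    assert (Hx : Rmin 0 1 <= x <= Rmax 0 1) by (rewrite Rmin_left, Rmax_right; lra).
    specialize (HB x Hx). change (Rabs (p x * 1) <= B) in HB.
    apply Rabs_le_between in HB. lra.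
  - intros x Hx Hns. apply continuous01_interior; [lra|].
    apply Hs; [unfold I01; lra | exact Hns].
Qed.

(** The scalar equation as a first-order system for [y] and [z = y']. Continuity
    on the whole line carries the information at the end points. *)
Definition solution (p : R -> R) (lam : R) (y z : R -> R) : Prop :=
  (forall x, continuous y x) /\ (forall x, continuous z x) /\
  (forall x, 0 < x < 1 -> is_derive y x (z x)) /\
  (forall x, 0 < x < 1 -> continuous p x -> is_derive z x (- (lam * p x * y x))).

(** * Gronwall estimate, uniqueness and dependence on the spectral parameter *)

(** The energy [E = d^2 + e^2] satisfies [E' <= (K + 2) * E + A^2], which makes
    [A^2 * x - E x * exp (- (K + 2) * x)] nondecreasing. *)
Lemma gronwall (s : list R) (d e de : R -> R) (K A : R) :
  0 <= K -> 0 <= A ->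
  (forall x, continuous d x) -> (forall x, continuous e x) ->
  (forall x, 0 < x < 1 -> ~ In x s ->
     is_derive d x (e x) /\ is_derive e x (de x) /\ Rabs (de x) <= K * Rabs (d x) + A) ->
  d 0 = 0 -> e 0 = 0 ->
  forall x, I01 x -> Rabs (d x) <= A * exp (K + 2) /\ Rabs (e x) <= A * exp (K + 2).
Proof.
  intros HK HA Hcd Hce Hd Hd0 He0 x Hx.
  set (L := K + 2).
  set (f := fun t => A * A * t - (d t * d t + e t * e t) * exp (- (L * t))).
  assert (Hmono : f 0 <= f x).
  { apply (nondecreasing_off_finite s f (fun t => A * A -
      (2 * d t * e t + 2 * e t * de t - L * (d t * d t + e t * e t)) * exp (- (L * t)))).
    - intros t. unfold f. cont.
    - apply Hx.
    - intros t Ht Hns. destruct Hx as [_ Hx].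
      destruct (Hd t) as [H1 [H2 H3]]; [lra | exact Hns |].
      split.
      + unfold f. derive_by_known. ring.
      + assert (Hexp : 0 < exp (- (L * t)) <= 1).
        { split; [apply exp_pos|]. rewrite <- exp_0. apply exp_le_mono.
          assert (0 <= L * t) by (apply Rmult_le_pos; unfold L; lra). lra. }
        assert (HE : 2 * d t * e t + 2 * e t * de t <=
                     L * (d t * d t + e t * e t) + A * A).
        { apply Rle_trans with (d t * d t + e t * e t + 2 * (Rabs (e t) * (K * Rabs (d t) + A))).
          - assert (e t * de t <= Rabs (e t) * (K * Rabs (d t) + A)).
            { apply Rle_trans with (1 := Rle_abs _). rewrite Rabs_mult.
              apply Rmult_le_compat_l; [apply Rabs_pos | exact H3]. }
            pose proof (Rle_0_sqr (d t - e t)). unfold Rsqr in *. nra.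
          - rewrite <- (Rabs_pos_eq (d t * d t)) by apply Rle_0_sqr.
            rewrite <- (Rabs_pos_eq (e t * e t)) by apply Rle_0_sqr.
            rewrite !Rabs_mult. unfold L.
            pose proof (Rle_0_sqr (Rabs (d t) - Rabs (e t))).
            pose proof (Rle_0_sqr (A - Rabs (e t))). unfold Rsqr in *. 
            pose proof (Rle_0_sqr (Rabs (d t))); unfold Rsqr in *. nra. }
        assert (0 <= A * A) by apply Rle_0_sqr. nra. }
  unfold f in Hmono. rewrite Hd0, He0 in Hmono.
  replace (A * A * 0 - (0 * 0 + 0 * 0) * exp (- (L * 0))) with 0 in Hmono by ring.
  rewrite exp_Ropp in Hmono.
  assert (HLx : 1 <= exp (L * x) <= exp L).
  { unfold I01 in Hx. assert (0 <= L * x <= L) by (unfold L in *; nra).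
    split; [rewrite <- exp_0|]; apply exp_le_mono; lra. }
  assert (HE : d x * d x + e x * e x <= A * exp L * (A * exp L)).
  { apply Rle_trans with (A * A * x * exp (L * x)).
    - replace (d x * d x + e x * e x) with
        ((d x * d x + e x * e x) * / exp (L * x) * exp (L * x))
        by (field; apply Rgt_not_eq, exp_pos).
      apply Rmult_le_compat_r; [left; apply exp_pos | lra].
    - assert (0 <= A * A) by apply Rle_0_sqr. unfold I01 in Hx.
      replace (A * exp L * (A * exp L)) with (A * A * (exp L * exp L)) by ring.
      rewrite Rmult_assoc. apply Rmult_le_compat_l; [assumption|]. nra. }
  pose proof (Rle_0_sqr (d x)). pose proof (Rle_0_sqr (e x)). unfold Rsqr in *.
  assert (0 <= A * exp L) by (apply Rmult_le_pos; [exact HA | left; apply exp_pos]).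
  split; apply Rsqr_incr_0_var; try assumption; rewrite <- Rsqr_abs; unfold Rsqr; lra.
Qed.

Section Weighted.
Context (p : R -> R) (s : list R) (c B : R) (Hp : weight p s c B).

Lemma weight_pos x : I01 x -> 0 < p x.
Proof. intros Hx. destruct Hp as [Hc [Hb _]]. specialize (Hb x Hx). lra. Qed.

Lemma weight_bound_pos : 0 < B.
Proof.
  destruct Hp as [Hc [Hb _]].
  assert (I01 0) as H0 by (unfold I01; lra). specialize (Hb 0 H0). lra.
Qed.

Lemma weight_abs_le x : I01 x -> Rabs (p x) <= B.
Proof.
  intros Hx. pose proof (weight_pos x Hx). rewrite Rabs_pos_eq by lra.
  apply Hp; exact Hx.
Qed.

(** The difference of two solutions with the same initial data solves the
    equation for [mu] with the source term [- (mu - lam) * p * y]. *)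
Lemma solution_dependence lam mu y z y' z' M :
  solution p lam y z -> solution p mu y' z' ->
  (forall x, I01 x -> Rabs (y x) <= M) -> 0 <= M ->
  y 0 = y' 0 -> z 0 = z' 0 ->
  let A := Rabs (mu - lam) * (B * M) in
  let K := Rabs mu * B in
  forall x, I01 x -> Rabs (y' x - y x) <= A * exp (K + 2) /\
                     Rabs (z' x - z x) <= A * exp (K + 2).
Proof.
  intros [Hy [Hz [Hdy Hdz]]] [Hy' [Hz' [Hdy' Hdz']]] HM HM0 E0 E1 A K.
  pose proof weight_bound_pos as HB.
  apply (gronwall s (fun x => y' x - y x) (fun x => z' x - z x)
    (fun x => - (mu * p x * (y' x - y x)) - (mu - lam) * p x * y x)).
  - apply Rmult_le_pos; [apply Rabs_pos | lra].
  - apply Rmult_le_pos; [apply Rabs_pos | nra].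
  - intros x. cont.
  - intros x. cont.
  - intros x Hx Hns.
    assert (HI : I01 x) by (unfold I01; lra).
    assert (Hcp : continuous p x) by (apply Hp; assumption).
    pose proof (Hdy x Hx). pose proof (Hdy' x Hx).
    pose proof (Hdz x Hx Hcp). pose proof (Hdz' x Hx Hcp).
    split; [|split].
    + derive_by_known. ring.
    + derive_by_known. ring.
    + apply Rle_trans with (1 := Rabs_triang _ _).
      pose proof (weight_abs_le x HI) as Hpx. pose proof (HM x HI) as Hyx.
      rewrite !Rabs_Ropp, !Rabs_mult. unfold A, K.
      pose proof (Rabs_pos (p x)). pose proof (Rabs_pos (y x)).
      pose proof (Rabs_pos (y' x - y x)). pose proof (Rabs_pos mu).
      pose proof (Rabs_pos (mu - lam)).
      apply Rplus_le_compat.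
      * apply Rmult_le_compat_r; [assumption|]. apply Rmult_le_compat_l; assumption.
      * rewrite Rmult_assoc. apply Rmult_le_compat_l; [assumption|].
        apply Rmult_le_compat; assumption.
  - rewrite E0; ring.
  - rewrite E1; ring.
Qed.

Lemma solution_unique lam y z y' z' :
  solution p lam y z -> solution p lam y' z' ->
  y 0 = y' 0 -> z 0 = z' 0 ->
  forall x, I01 x -> y' x = y x /\ z' x = z x.
Proof.
  intros H H' E0 E1 x Hx.
  destruct (continuous_bounded01 y (proj1 H)) as [M [HM0 HM]].
  destruct (solution_dependence lam lam y z y' z' M H H' HM HM0 E0 E1 x Hx) as [H1 H2].
  rewrite Rminus_diag, Rabs_R0, !Rmult_0_l in H1, H2.
  pose proof (Rabs_pos (y' x - y x)). pose proof (Rabs_pos (z' x - z x)).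
  split; apply Rminus_diag_uniq; apply Rabs_eq_0; lra.
Qed.

(** The energy [y^2 + z^2] decays at most exponentially, so it cannot reach zero
    unless it starts at zero. *)
Lemma solution_no_double_zero lam y z x :
  solution p lam y z -> I01 x -> y x = 0 -> z x = 0 -> y 0 = 0 /\ z 0 = 0.
Proof.
  intros [Hy [Hz [Hdy Hdz]]] Hx Hyx Hzx.
  pose proof weight_bound_pos as HB.
  set (K := 1 + Rabs lam * B).
  (* K bounds the decay rate, since 2 * y * z * (1 - lam * p) is at least - K * (y^2 + z^2) *)
  set (f := fun t => (y t * y t + z t * z t) * exp (K * t)).
  assert (Hmono : f 0 <= f x).
  { apply (nondecreasing_off_finite s f (fun t =>
      (2 * y t * z t + 2 * z t * (- (lam * p t * y t)) + K * (y t * y t + z t * z t))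
        * exp (K * t))).
    - intros t. unfold f. cont.
    - apply Hx.
    - intros t Ht Hns. destruct Hx as [_ Hx].
      assert (Ht' : 0 < t < 1) by lra. assert (HI : I01 t) by (unfold I01; lra).
      assert (Hcp : continuous p t) by (apply Hp; assumption).
      pose proof (Hdy t Ht'). pose proof (Hdz t Ht' Hcp).
      split.
      + unfold f. derive_by_known. ring.
      + apply Rmult_le_pos; [|left; apply exp_pos].
        assert (Hk : Rabs (1 - lam * p t) <= K).
        { apply Rle_trans with (1 := Rabs_triang _ _).
          rewrite Rabs_R1, Rabs_Ropp, Rabs_mult. unfold K.
          pose proof (weight_abs_le t HI). pose proof (Rabs_pos lam). nra. }
        apply Rabs_le_between in Hk.
        pose proof (Rle_0_sqr (y t - z t)). pose proof (Rle_0_sqr (y t + z t)).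
        unfold Rsqr in *. nra. }
  unfold f in Hmono. rewrite Hyx, Hzx, Rmult_0_r, exp_0 in Hmono.
  split; nra.
Qed.

End Weighted.

(** * Existence of solutions by Picard iteration *)

(** Integrating the system once: [slope_step] produces the increment of [y'] and
    [value_step] that of [y], for given values [f] of the solution. *)
Definition slope_step (p : R -> R) (lam : R) (f : R -> R) (x : R) : R :=
  - lam * RInt (fun t => p t * f t) 0 (clamp x).

Definition value_step (p : R -> R) (lam : R) (f : R -> R) (x : R) : R :=
  RInt (slope_step p lam f) 0 (clamp x).

Fixpoint picard_term (p : R -> R) (lam y0 z0 : R) (n : nat) : R -> R :=
  match n with
  | O => fun x => y0 + z0 * clamp x
  | S n => value_step p lam (picard_term p lam y0 z0 n)
  end.

Definition picard_sum p lam y0 z0 (n : nat) (x : R) : R :=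
  sum_n (fun k => picard_term p lam y0 z0 k x) n.

(** The Neumann series of the integral equation. It is convenient to keep all
    terms clamped, because the bounds then hold on the whole line. *)
Definition picard_limit p lam y0 z0 (x : R) : R :=
  Series (fun k => picard_term p lam y0 z0 k x).

Definition ivp_slope p lam y0 z0 (x : R) : R :=
  z0 + slope_step p lam (picard_limit p lam y0 z0) x.

(** On [[0,1]] this is [picard_limit]; integrating [ivp_slope] without clamping
    gives a function differentiable on the whole line, in particular at 0 and 1. *)
Definition ivp_value p lam y0 z0 (x : R) : R :=
  y0 + RInt (ivp_slope p lam y0 z0) 0 x.

Section Existence.
Context (p : R -> R) (s : list R) (c B : R) (Hp : weight p s c B).

Lemma weight_mult_bounded (f : R -> R) :
  (forall x, continuous f x) ->
  exists M, forall x, I01 x -> Rabs (p x * f x) <= M.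
Proof.
  intros Hf. destruct (continuous_bounded01 f Hf) as [M [HM0 HM]].
  exists (B * M). intros x Hx. rewrite Rabs_mult.
  apply Rmult_le_compat; try apply Rabs_pos; [|apply HM, Hx].
  apply (weight_abs_le p s c B Hp x Hx).
Qed.

Lemma weight_mult_ex_RInt (f : R -> R) x y :
  (forall x, continuous f x) -> I01 x -> I01 y -> x <= y ->
  ex_RInt (fun t => p t * f t) x y.
Proof. intros Hf. apply Hp. exact Hf. Qed.

Lemma slope_step_continuous lam f :
  (forall x, continuous f x) -> forall x, continuous (slope_step p lam f) x.
Proof.
  intros Hf x. destruct (weight_mult_bounded f Hf) as [M HM].
  unfold slope_step.
  apply continuous_Rmult; [apply continuous_const|].
  apply (continuous_RInt_clamp _ M); [|exact HM].
  intros u v. apply weight_mult_ex_RInt, Hf.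
Qed.

Lemma value_step_continuous lam f :
  (forall x, continuous f x) -> forall x, continuous (value_step p lam f) x.
Proof.
  intros Hf. pose proof (slope_step_continuous lam f Hf) as Hs.
  destruct (continuous_bounded01 _ Hs) as [M [_ HM]].
  apply (continuous_RInt_clamp _ M); [|exact HM].
  intros u v _ _ _. apply continuous_ex_RInt, Hs.
Qed.

Lemma slope_step_plus lam f g :
  (forall x, continuous f x) -> (forall x, continuous g x) ->
  forall x, slope_step p lam (fun t => f t + g t) x = slope_step p lam f x + slope_step p lam g x.
Proof.
  intros Hf Hg x. unfold slope_step. rewrite <- Rmult_plus_distr_l. f_equal.
  assert (H0 : I01 0) by (unfold I01; lra). pose proof (clamp_I01 x) as Hx.
  pose proof (weight_mult_ex_RInt f 0 _ Hf H0 Hx (proj1 Hx)).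
  pose proof (weight_mult_ex_RInt g 0 _ Hg H0 Hx (proj1 Hx)).
  rewrite <- (RInt_plus (V := R_CompleteNormedModule)) by assumption.
  apply RInt_ext. intros t _. apply Rmult_plus_distr_l.
Qed.

Lemma value_step_plus lam f g :
  (forall x, continuous f x) -> (forall x, continuous g x) ->
  forall x, value_step p lam (fun t => f t + g t) x = value_step p lam f x + value_step p lam g x.
Proof.
  intros Hf Hg x. unfold value_step.
  rewrite <- (RInt_plus (V := R_CompleteNormedModule))
    by (apply continuous_ex_RInt, slope_step_continuous; assumption).
  apply RInt_ext. intros t _. apply slope_step_plus; assumption.
Qed.

Lemma value_step_ext lam f g :
  (forall x, f x = g x) -> forall x, value_step p lam f x = value_step p lam g x.
Proof.
  intros H x. apply RInt_ext. intros t _. unfold slope_step. f_equal.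
  apply RInt_ext. intros u _. now rewrite H.
Qed.

(** In the norm weighted by [exp (K * x)] with [K] large, integration gains a
    factor [1 / K], which absorbs the size of [lam * p]. *)
Lemma value_step_contracts lam f M :
  (forall x, continuous f x) -> 0 <= M ->
  let K := 2 * (Rabs lam * B) + 1 in
  (forall x, Rabs (f x) <= M * exp (K * clamp x)) ->
  forall x, Rabs (value_step p lam f x) <= M / 2 * exp (K * clamp x).
Proof.
  intros Hf HM K Hb.
  pose proof (weight_bound_pos p s c B Hp) as HB.
  pose proof (Rabs_pos lam) as Hl.
  assert (HK : 1 <= K) by (unfold K; nra).
  assert (H0 : I01 0) by (unfold I01; lra).
  (* the inner integration yields the factor 1/2, as B * Rabs lam / K is at most 1/2; for the outer one K >= 1 suffices *)
  assert (Hs : forall x, Rabs (slope_step p lam f x) <= M / 2 * exp (K * clamp x)).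
  { intros x. unfold slope_step. rewrite Rabs_mult, Rabs_Ropp.
    pose proof (clamp_I01 x) as Hx.
    assert (H : Rabs (RInt (fun t => p t * f t) 0 (clamp x)) <= B * M / K * exp (K * clamp x)).
    { apply RInt_exp_bound; [lra | nra | apply Hx | |].
      - apply weight_mult_ex_RInt; [exact Hf | exact H0 | exact Hx | apply Hx].
      - intros t Ht. assert (HIt : I01 t) by (unfold I01 in *; lra).
        specialize (Hb t). rewrite (clamp_id t HIt) in Hb.
        rewrite Rabs_mult, Rmult_assoc.
        apply Rmult_le_compat; try apply Rabs_pos; [|exact Hb].
        apply (weight_abs_le p s c B Hp t HIt). }
    apply Rle_trans with (Rabs lam * (B * M / K * exp (K * clamp x))).
    { apply Rmult_le_compat_l; assumption. }
    rewrite <- Rmult_assoc. apply Rmult_le_compat_r; [left; apply exp_pos|].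
    apply Rmult_le_reg_r with K; [lra|].
    replace (Rabs lam * (B * M / K) * K) with (Rabs lam * B * M) by (field; lra).
    unfold K. nra. }
  intros x. pose proof (clamp_I01 x) as Hx.
  apply Rle_trans with (M / 2 / K * exp (K * clamp x)).
  - apply RInt_exp_bound; [lra | lra | apply Hx | |].
    + apply continuous_ex_RInt, slope_step_continuous, Hf.
    + intros t Ht. assert (HIt : I01 t) by (unfold I01 in *; lra).
      specialize (Hs t). rewrite (clamp_id t HIt) in Hs. exact Hs.
  - apply Rmult_le_compat_r; [left; apply exp_pos|].
    apply Rmult_le_reg_r with K; [lra|].
    replace (M / 2 / K * K) with (M / 2) by (field; lra). nra.
Qed.

Section Ivp.
Context (lam y0 z0 : R).
Let term := picard_term p lam y0 z0.
Let psum := picard_sum p lam y0 z0.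
Let limit := picard_limit p lam y0 z0.
Let K := 2 * (Rabs lam * B) + 1.
Let C := (Rabs y0 + Rabs z0) * exp K.

Lemma picard_term_continuous n : forall x, continuous (term n) x.
Proof.
  induction n as [|n IH].
  - intros x. unfold term; simpl. pose proof clamp_continuous. cont.
  - apply value_step_continuous, IH.
Qed.

Lemma picard_const_nonneg : 0 <= C.
Proof.
  unfold C. apply Rmult_le_pos; [|left; apply exp_pos].
  pose proof (Rabs_pos y0). pose proof (Rabs_pos z0). lra.
Qed.

Lemma picard_rate_ge_1 : 1 <= K.
Proof.
  pose proof (weight_bound_pos p s c B Hp). pose proof (Rabs_pos lam). unfold K; nra.
Qed.

Lemma picard_term_bound n x : Rabs (term n x) <= C * (1 / 2) ^ n.
Proof.
  pose proof picard_rate_ge_1 as HK.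
  assert (H : forall x, Rabs (term n x) <=
     (Rabs y0 + Rabs z0) * (1 / 2) ^ n * exp (K * clamp x)).
  { clear x. induction n as [|n IH]; intros x.
    - unfold term; simpl. pose proof (clamp_I01 x) as [Hx0 Hx1].
      assert (1 <= exp (K * clamp x)).
      { rewrite <- exp_0. apply exp_le_mono. nra. }
      apply Rle_trans with (1 := Rabs_triang _ _).
      rewrite Rabs_mult, (Rabs_pos_eq (clamp x)) by assumption.
      pose proof (Rabs_pos y0). pose proof (Rabs_pos z0). nra.
    - replace ((Rabs y0 + Rabs z0) * (1 / 2) ^ S n) with
        ((Rabs y0 + Rabs z0) * (1 / 2) ^ n / 2) by (simpl; field).
      apply value_step_contracts; [apply picard_term_continuous | | exact IH].
      apply Rmult_le_pos; [|apply pow_le; lra].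
      pose proof (Rabs_pos y0). pose proof (Rabs_pos z0). lra. }
  apply Rle_trans with (1 := H x). unfold C.
  rewrite !Rmult_assoc. apply Rmult_le_compat_l.
  { pose proof (Rabs_pos y0). pose proof (Rabs_pos z0). lra. }
  rewrite Rmult_comm. apply Rmult_le_compat_r; [apply pow_le; lra|].
  apply exp_le_mono. pose proof (clamp_I01 x) as [Hx0 Hx1]. nra.
Qed.

Lemma picard_tail n x : Rabs (limit x - psum n x) <= C * (1 / 2) ^ n.
Proof.
  assert (Hgeom : is_series (fun k => C * (1 / 2) ^ S n * (1 / 2) ^ k) (C * (1 / 2) ^ n)).
  { replace (C * (1 / 2) ^ n) with (C * (1 / 2) ^ S n * / (1 - 1 / 2)) by (simpl; field).
    apply (is_series_scal (K := R_AbsRing) (V := R_NormedModule) (C * (1 / 2) ^ S n)).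
    apply is_series_geom. rewrite Rabs_pos_eq; lra. }
  assert (Hb : forall k, Rabs (term (S n + k)%nat x) <= C * (1 / 2) ^ S n * (1 / 2) ^ k).
  { intros k. rewrite Rmult_assoc, <- pow_add. apply picard_term_bound. }
  assert (Hex : ex_series (fun k => term (S n + k)%nat x)).
  { apply (ex_series_le (K := R_AbsRing) (V := R_CompleteNormedModule) _
      (fun k => C * (1 / 2) ^ S n * (1 / 2) ^ k)); [exact Hb | eexists; exact Hgeom]. }
  assert (Hex0 : ex_series (fun k => term k x)).
  { apply (ex_series_incr_n (K := R_AbsRing) (V := R_NormedModule) _ (S n)), Hex. }
  unfold limit, picard_limit, psum, picard_sum. fold term.
  rewrite (Series_incr_n _ (S n)) by (auto; lia).
  rewrite sum_n_Reals. simpl (Init.Nat.pred (S n)).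
  replace (_ + _ - _) with (Series (fun k => term (S n + k)%nat x)) by ring.
  rewrite <- (is_series_unique _ _ Hgeom).
  assert (Hexa : ex_series (fun k => Rabs (term (S n + k)%nat x))).
  { apply (ex_series_le (K := R_AbsRing) (V := R_CompleteNormedModule) _
      (fun k => C * (1 / 2) ^ S n * (1 / 2) ^ k)); [|eexists; exact Hgeom].
    intros k. change (Rabs (Rabs (term (S n + k)%nat x)) <= C * (1 / 2) ^ S n * (1 / 2) ^ k).
    rewrite Rabs_Rabsolu. apply Hb. }
  apply Rle_trans with (1 := Series_Rabs _ Hexa).
  apply Series_le; [|eexists; exact Hgeom].
  intros k. split; [apply Rabs_pos | apply Hb].
Qed.

Lemma picard_sum_continuous n : forall x, continuous (psum n) x.
Proof.
  induction n as [|n IH]; intros x.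
  - apply (continuous_ext (term 0)); [|apply picard_term_continuous].
    intros t. unfold psum, picard_sum. now rewrite sum_O.
  - apply (continuous_ext (fun t => psum n t + term (S n) t)).
    { intros t. unfold psum, picard_sum. now rewrite sum_Sn. }
    apply continuous_Rplus; [apply IH | apply picard_term_continuous].
Qed.

Lemma picard_sum_step n x : psum (S n) x = term 0 x + value_step p lam (psum n) x.
Proof.
  assert (HS : forall n x, psum (S n) x = psum n x + term (S n) x).
  { intros m t. unfold psum, picard_sum. now rewrite sum_Sn. }
  assert (H0 : forall x, psum 0 x = term 0 x).
  { intros t. unfold psum, picard_sum. now rewrite sum_O. }
  induction n as [|n IH].
  - rewrite HS, H0. rewrite (value_step_ext lam (psum 0) (term 0) H0). reflexivity.
  - rewrite HS, IH, (value_step_ext lam (psum (S n)) (fun t => psum n t + term (S n) t)) by apply HS.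
    rewrite value_step_plus; [|apply picard_sum_continuous | apply picard_term_continuous].
    change (term (S (S n)) x) with (value_step p lam (term (S n)) x). ring.
Qed.

Lemma picard_limit_continuous x : continuous limit x.
Proof.
  apply continuous_of_approx. intros eps.
  destruct (half_pow_small C eps picard_const_nonneg (cond_pos eps)) as [n Hn].
  exists (psum n). split; [apply picard_sum_continuous|].
  intros t. apply Rle_trans with (2 := Hn). apply picard_tail.
Qed.

Lemma picard_limit_fixed x : limit x = y0 + z0 * clamp x + value_step p lam limit x.
Proof.
  pose proof picard_const_nonneg as HC. pose proof picard_rate_ge_1 as HK.
  apply Rminus_diag_uniq, Rabs_eq_0, Rle_antisym; [|apply Rabs_pos].
  apply le_epsilon. intros eps He. rewrite Rplus_0_l.
  destruct (half_pow_small (C + C * exp K) eps) as [n Hn]; [|exact He|].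
  { pose proof (exp_pos K). nra. }
  apply Rle_trans with (2 := Hn).
  assert (E : value_step p lam limit x =
    value_step p lam (psum n) x + value_step p lam (fun t => limit t - psum n t) x).
  { rewrite <- value_step_plus; [| apply picard_sum_continuous |
      intros t; apply continuous_Rminus; [apply picard_limit_continuous | apply picard_sum_continuous]].
    apply value_step_ext. intros t. ring. }
  assert (Hr : Rabs (value_step p lam (fun t => limit t - psum n t) x) <= C * exp K * (1 / 2) ^ n).
  { apply Rle_trans with (C * (1 / 2) ^ n / 2 * exp (K * clamp x)).
    - apply value_step_contracts.
      + intros t.
        apply continuous_Rminus; [apply picard_limit_continuous | apply picard_sum_continuous].
      + apply Rmult_le_pos; [exact HC | apply pow_le; lra].
      + intros t. apply Rle_trans with (1 := picard_tail n t).
        fold K. rewrite <- (Rmult_1_r (C * (1 / 2) ^ n)) at 1.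
        apply Rmult_le_compat_l; [apply Rmult_le_pos; [exact HC | apply pow_le; lra]|].
        rewrite <- exp_0. apply exp_le_mono. pose proof (clamp_I01 t) as [? ?]. nra.
    - assert (Hc : exp (K * clamp x) <= exp K).
      { apply exp_le_mono. pose proof (clamp_I01 x) as [? ?]. nra. }
      pose proof (exp_pos (K * clamp x)).
      assert (0 <= C * (1 / 2) ^ n) by (apply Rmult_le_pos; [exact HC | apply pow_le; lra]).
      nra. }
  pose proof (picard_tail (S n) x) as Ht. rewrite picard_sum_step in Ht.
  change (term 0 x) with (y0 + z0 * clamp x) in Ht. rewrite E.
  assert (Hpow : C * (1 / 2) ^ S n <= C * (1 / 2) ^ n).
  { simpl. assert (0 <= C * (1 / 2) ^ n) by (apply Rmult_le_pos; [exact HC | apply pow_le; lra]). lra. }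
  apply Rabs_le_between in Ht. apply Rabs_le_between in Hr. apply Rabs_le_between. lra.
Qed.

Lemma ivp_slope_continuous x : continuous (ivp_slope p lam y0 z0) x.
Proof.
  unfold ivp_slope. apply continuous_Rplus; [apply continuous_const|].
  apply slope_step_continuous, picard_limit_continuous.
Qed.

Lemma ivp_value_is_derive x : is_derive (ivp_value p lam y0 z0) x (ivp_slope p lam y0 z0 x).
Proof.
  unfold ivp_value.
  replace (ivp_slope p lam y0 z0 x) with (0 + ivp_slope p lam y0 z0 x) by ring.
  apply (is_derive_plus (V := R_NormedModule)); [apply (is_derive_const (K := R_AbsRing) (V := R_NormedModule))|].
  apply (is_derive_RInt (V := R_NormedModule)) with (a := 0); [|apply ivp_slope_continuous].
  apply filter_forall. intros b. apply (RInt_correct (V := R_CompleteNormedModule)).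
  apply continuous_ex_RInt, ivp_slope_continuous.
Qed.

Lemma ivp_value_limit x : I01 x -> ivp_value p lam y0 z0 x = limit x.
Proof.
  intros Hx. rewrite picard_limit_fixed, (clamp_id x Hx).
  unfold ivp_value, value_step. rewrite (clamp_id x Hx).
  assert (E : RInt (ivp_slope p lam y0 z0) 0 x =
     RInt (fun _ => z0) 0 x + RInt (slope_step p lam limit) 0 x).
  { rewrite <- (RInt_plus (V := R_CompleteNormedModule)); [reflexivity| |].
    - apply continuous_ex_RInt. intros t. apply continuous_const.
    - apply continuous_ex_RInt, slope_step_continuous, picard_limit_continuous. }
  rewrite E, RInt_const. unfold scal; simpl; unfold mult; simpl. ring.
Qed.

Lemma ivp_slope_is_derive x : 0 < x < 1 -> continuous p x ->
  is_derive (ivp_slope p lam y0 z0) x (- (lam * p x * ivp_value p lam y0 z0 x)).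
Proof.
  intros Hx Hcp.
  assert (HI : I01 x) by (unfold I01; lra).
  rewrite (ivp_value_limit x HI).
  apply (is_derive_ext_loc (fun t => z0 + - lam * RInt (fun t => p t * limit t) 0 t)).
  { generalize (locally_open_interval 0 1 x Hx). apply filter_imp. intros t Ht.
    unfold ivp_slope, slope_step. rewrite clamp_id by (unfold I01; lra). reflexivity. }
  assert (HD : is_derive (fun t => RInt (fun t => p t * limit t) 0 t) x (p x * limit x)).
  { apply (is_derive_RInt (V := R_NormedModule) (fun t => p t * limit t)) with (a := 0).
    - generalize (locally_open_interval 0 1 x Hx). apply filter_imp. intros t Ht.
      apply (RInt_correct (V := R_CompleteNormedModule)).
      apply weight_mult_ex_RInt; [apply picard_limit_continuous | | |]; unfold I01; lra.
    - apply continuous_Rmult; [exact Hcp | apply picard_limit_continuous]. }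
  replace (- (lam * p x * limit x)) with (0 + - lam * (p x * limit x)) by ring.
  apply (is_derive_plus (V := R_NormedModule)); [apply (is_derive_const (K := R_AbsRing) (V := R_NormedModule))|].
  apply is_derive_scal, HD.
Qed.

Lemma ivp_solution :
  solution p lam (ivp_value p lam y0 z0) (ivp_slope p lam y0 z0) /\
  ivp_value p lam y0 z0 0 = y0 /\ ivp_slope p lam y0 z0 0 = z0.
Proof.
  split; [split; [|split; [|split]]|split].
  - intros x. eapply continuous_of_is_derive, ivp_value_is_derive.
  - apply ivp_slope_continuous.
  - intros x _. apply ivp_value_is_derive.
  - apply ivp_slope_is_derive.
  - unfold ivp_value. rewrite RInt_point. apply Rplus_0_r.
  - unfold ivp_slope, slope_step. rewrite clamp_id by (unfold I01; lra).
    rewrite RInt_point. unfold zero; simpl. ring.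
Qed.
End Ivp.
End Existence.

(** * Positivity of the lowest eigenfunction *)

(** Away from 0 the function has a positive minimum. If it vanishes at 0, its
    positive slope there handles a neighbourhood of 0, which is why closeness of
    the derivatives is also required. *)
Lemma positivity_stable (y z : R -> R) :
  (forall x, continuous y x) -> (forall x, continuous z x) ->
  0 <= y 0 -> (y 0 = 0 -> 0 < z 0) -> (forall x, 0 < x <= 1 -> 0 < y x) ->
  exists eps, 0 < eps /\ forall y' z' : R -> R,
    (forall x, continuous y' x) ->
    (forall x, 0 < x < 1 -> is_derive y' x (z' x)) -> y' 0 = y 0 ->
    (forall x, I01 x -> Rabs (y' x - y x) <= eps /\ Rabs (z' x - z x) <= eps) ->
    forall x, 0 < x <= 1 -> 0 < y' x.
Proof.
  intros Hy Hz H0 Hz0 Hpos.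
  destruct (Rle_lt_or_eq_dec _ _ H0) as [Hy0|Hy0].
  - destruct (continuous_positive_min y 0 1) as [m [Hm Hmin]]; [lra | exact Hy | |].
    { intros x Hx. destruct (Req_dec x 0) as [->|Hne]; [exact Hy0 | apply Hpos; lra]. }
    exists (m / 2). split; [lra|]. intros y' z' _ _ _ Hclose x Hx.
    assert (HI : I01 x) by (unfold I01; lra).
    destruct (Hclose x HI) as [Hc _]. apply Rabs_le_between in Hc.
    specialize (Hmin x HI). lra.
  - symmetry in Hy0. specialize (Hz0 Hy0).
    destruct (continuous_pos_near z 0 (Hz 0) Hz0) as [d [Hd Hnear]].
    set (r := Rmin (d / 2) 1).
    assert (Hr : 0 < r /\ r < d /\ r <= 1).
    { unfold r, Rmin. destruct Rle_dec; lra. }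
    destruct (continuous_positive_min y r 1) as [m [Hm Hmin]]; [lra | exact Hy | |].
    { intros x Hx. apply Hpos; lra. }
    exists (Rmin (m / 2) (z 0 / 4)).
    pose proof (Rmin_l (m / 2) (z 0 / 4)). pose proof (Rmin_r (m / 2) (z 0 / 4)).
    split; [apply Rmin_glb_lt; lra|].
    intros y' z' Hcy' Hdy' E Hclose x Hx.
    destruct (Rle_dec r x).
    + assert (HI : I01 x) by (unfold I01; lra).
      destruct (Hclose x HI) as [Hc _]. apply Rabs_le_between in Hc.
      specialize (Hmin x). lra.
    + destruct (mean_value y' z' 0 x) as [t [Ht Hmv]]; [lra | exact Hcy' | |].
      { intros t Ht. apply Hdy'; lra. }
      assert (HI : I01 t) by (unfold I01; lra).
      destruct (Hclose t HI) as [_ Hc]. apply Rabs_le_between in Hc.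
      assert (z 0 / 2 < z t) by (apply Hnear; rewrite Rabs_pos_eq; lra).
      rewrite E, Hy0 in Hmv. nra.
Qed.

Section GroundState.
Context (p : R -> R) (s : list R) (c B : R) (Hp : weight p s c B).

(** A barrier for the Riccati equation of [z / y]. Choose a linear [g] with
    [g 0 * y0 < z0] and [g 1 = g1], and put [w = z - g * y]. The equation gives
    [w' = (k * p - g' - g^2) * y - g * w], where the first coefficient is
    nonnegative for large [k]. Then [y * w] is nondecreasing, hence nonnegative,
    and so with [G' = g] the square of [exp G * w] is nondecreasing. Thus [w]
    keeps its initial positive sign, which gives [z > g * y] up to the end point
    and makes [exp (- G) * y] increasing. *)
Lemma strongly_negative_parameter (y0 z0 g1 : R) :
  0 <= y0 -> (y0 = 0 -> 0 < z0) ->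
  exists k0, forall k, k0 <= k -> forall y z, solution p (- k) y z -> y 0 = y0 -> z 0 = z0 ->
    (forall x, 0 < x <= 1 -> 0 < y x) /\ g1 * y 1 < z 1.
Proof.
  intros Hy0 Hz0.
  assert (HA : exists A, 0 < z0 - A * y0).
  { destruct (Rle_lt_or_eq_dec _ _ Hy0) as [Hpos|E].
    - exists ((z0 - 1) / y0). replace (z0 - (z0 - 1) / y0 * y0) with 1 by (field; lra). lra.
    - exists 0. rewrite Rmult_0_l, Rminus_0_r. apply Hz0. now symmetry. }
  destruct HA as [A HA].
  set (D := g1 - A).
  set (g := fun x => A + D * x).
  set (G := fun x => A * x + D * (x * x) / 2).
  (* Q bounds g' + g^2 on the unit interval, where g' = D *)
  set (Q := Rabs D + (Rabs A + Rabs D) * (Rabs A + Rabs D)).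
  assert (Hc : 0 < c) by apply Hp.
  assert (HQ : 0 <= Q).
  { unfold Q. pose proof (Rabs_pos D). pose proof (Rabs_pos A). nra. }
  exists (Q / c). intros k Hk y z [Hcy [Hcz [Hdy Hdz]]] Ey Ez.
  assert (Hkp : forall x, 0 < x < 1 -> 0 <= k * p x - D - g x * g x).
  { intros x Hx. assert (HI : I01 x) by (unfold I01; lra).
    assert (Hpx : c <= p x) by (apply Hp; exact HI).
    assert (HQk : Q <= k * p x).
    { apply Rle_trans with (k * c).
      - apply Rmult_le_reg_r with (/ c); [apply Rinv_0_lt_compat, Hc|].
        replace (k * c * / c) with k by (field; lra). exact Hk.
      - apply Rmult_le_compat_l; [|exact Hpx].
        apply Rle_trans with (2 := Hk). apply Rdiv_le_0_compat; lra. }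
    assert (Hg : Rabs (g x) <= Rabs A + Rabs D).
    { unfold g. apply Rle_trans with (1 := Rabs_triang _ _).
      rewrite Rabs_mult, (Rabs_pos_eq x) by lra. pose proof (Rabs_pos D). nra. }
    assert (g x * g x <= (Rabs A + Rabs D) * (Rabs A + Rabs D)).
    { rewrite <- (Rabs_pos_eq (g x * g x)) by apply Rle_0_sqr. rewrite Rabs_mult.
      apply Rmult_le_compat; try apply Rabs_pos; exact Hg. }
    pose proof (Rle_abs D). unfold Q in HQk. lra. }
  set (w := fun x => z x - g x * y x).
  assert (Hcg : forall x, continuous g x) by (intros x; unfold g; cont).
  assert (HcG : forall x, continuous G x) by (intros x; unfold G, Rdiv; cont).
  assert (Hcw : forall x, continuous w x) by (intros x; unfold w; cont).
  assert (Hw0 : 0 < w 0).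
  { unfold w, g. rewrite Ey, Ez. replace (z0 - (A + D * 0) * y0) with (z0 - A * y0) by ring.
    exact HA. }
  assert (Hyw : forall x, I01 x -> 0 <= y x * w x).
  { intros x [Hx0 Hx1]. apply Rle_trans with (y 0 * w 0).
    { rewrite Ey. apply Rmult_le_pos; lra. }
    apply (nondecreasing_off_finite s (fun x => y x * w x)
      (fun x => w x * w x + (k * p x - D - g x * g x) * (y x * y x))).
    - intros t. cont.
    - exact Hx0.
    - intros t Ht Hns. assert (Ht' : 0 < t < 1) by lra.
      assert (Hcp : continuous p t) by (apply Hp; assumption).
      pose proof (Hdy t Ht'). pose proof (Hdz t Ht' Hcp). split.
      + unfold w, g. derive_by_known. ring.
      + pose proof (Hkp t Ht'). pose proof (Rle_0_sqr (w t)). pose proof (Rle_0_sqr (y t)).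
        unfold Rsqr in *. nra. }
  assert (Hwne : forall x, I01 x -> w x <> 0).
  { intros x [Hx0 Hx1] E.
    assert (Hmono : exp (2 * G 0) * (w 0 * w 0) <= exp (2 * G x) * (w x * w x)).
    { apply (nondecreasing_off_finite s (fun x => exp (2 * G x) * (w x * w x))
        (fun x => exp (2 * G x) * (2 * (k * p x - D - g x * g x) * (y x * w x)))).
      - intros t. cont.
      - exact Hx0.
      - intros t Ht Hns. assert (Ht' : 0 < t < 1) by lra.
        assert (HI : I01 t) by (unfold I01; lra).
        assert (Hcp : continuous p t) by (apply Hp; assumption).
        pose proof (Hdy t Ht'). pose proof (Hdz t Ht' Hcp). split.
        + unfold w, g, G. derive_by_known. unfold Rdiv. field.
        + pose proof (Hkp t Ht'). pose proof (Hyw t HI).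
          apply Rmult_le_pos; [left; apply exp_pos|]. nra. }
    rewrite E in Hmono. pose proof (exp_pos (2 * G 0)).
    assert (0 < w 0 * w 0) by nra. nra. }
  assert (Hw : forall x, I01 x -> 0 < w x).
  { intros x Hx. destruct (Rlt_dec 0 (w x)) as [Hlt|Hnlt]; [exact Hlt|exfalso].
    destruct (IVT_gen_consistent w 0 x 0 Hcw) as [t [Ht Et]].
    { unfold Rmin, Rmax; destruct Rle_dec; lra. }
    destruct Hx as [Hx0 Hx1]. rewrite Rmin_left, Rmax_right in Ht by exact Hx0.
    apply (Hwne t); [unfold I01; lra | exact Et]. }
  assert (Hpos : forall x, 0 < x <= 1 -> 0 < y x).
  { intros x Hx.
    destruct (mean_value (fun x => exp (- G x) * y x) (fun x => exp (- G x) * w x) 0 x)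
      as [t [Ht E]]; [lra | intros t; cont | |].
    - intros t Ht. assert (Ht' : 0 < t < 1) by lra. pose proof (Hdy t Ht').
      unfold w, g, G. derive_by_known. unfold Rdiv. field.
    - assert (HI : I01 t) by (unfold I01; lra).
      pose proof (exp_pos (- G t)). pose proof (exp_pos (- G x)). pose proof (exp_pos (- G 0)).
      assert (0 < exp (- G t) * w t * (x - 0)).
      { apply Rmult_lt_0_compat; [apply Rmult_lt_0_compat; auto | lra]. }
      assert (0 <= exp (- G 0) * y 0) by (rewrite Ey; apply Rmult_le_pos; lra).
      nra. }
  split; [exact Hpos|].
  assert (H1 : I01 1) by (unfold I01; lra). specialize (Hw 1 H1).
  unfold w, g, D in Hw. replace (A + (g1 - A) * 1) with g1 in Hw by ring. lra.
Qed.

Section Shooting.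
Context (a b : R) (ha : 0 < a <= PI) (hb : 0 <= b < PI).

(** Solutions satisfying the boundary condition at 0, whatever [lam] is;
    [shot_defect] measures the failure of the condition at 1. *)
Definition shot (lam : R) : R -> R := ivp_value p lam (sin a) (- cos a).
Definition shot_slope (lam : R) : R -> R := ivp_slope p lam (sin a) (- cos a).
Definition shot_defect (lam : R) : R := shot lam 1 * cos b + shot_slope lam 1 * sin b.

Lemma shot_solution lam : solution p lam (shot lam) (shot_slope lam).
Proof. exact (proj1 (ivp_solution p s c B Hp lam _ _)). Qed.

Lemma shot_0 lam : shot lam 0 = sin a.
Proof. exact (proj1 (proj2 (ivp_solution p s c B Hp lam _ _))). Qed.

Lemma shot_slope_0 lam : shot_slope lam 0 = - cos a.
Proof. exact (proj2 (proj2 (ivp_solution p s c B Hp lam _ _))). Qed.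

Lemma sin_a_nonneg : 0 <= sin a.
Proof. apply sin_ge_0; lra. Qed.

Lemma shot_slope_0_pos : sin a = 0 -> 0 < - cos a.
Proof.
  intros E. destruct (Req_dec a PI) as [->|Hne]; [rewrite cos_PI; lra|].
  pose proof (sin_gt_0 a). lra.
Qed.

Lemma shot_lipschitz lam :
  exists L, 0 <= L /\ forall mu, Rabs (mu - lam) <= 1 -> forall x, I01 x ->
    Rabs (shot mu x - shot lam x) <= L * Rabs (mu - lam) /\
    Rabs (shot_slope mu x - shot_slope lam x) <= L * Rabs (mu - lam).
Proof.
  destruct (continuous_bounded01 (shot lam) (proj1 (shot_solution lam))) as [M [HM0 HM]].
  pose proof (weight_bound_pos p s c B Hp) as HB.
  exists (B * M * exp ((Rabs lam + 1) * B + 2)).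
  assert (HBM : 0 <= B * M) by (apply Rmult_le_pos; lra).
  split; [apply Rmult_le_pos; [exact HBM | left; apply exp_pos]|].
  intros mu Hmu x Hx.
  assert (Hle : Rabs (mu - lam) * (B * M) * exp (Rabs mu * B + 2) <=
                B * M * exp ((Rabs lam + 1) * B + 2) * Rabs (mu - lam)).
  { replace (Rabs (mu - lam) * (B * M) * exp (Rabs mu * B + 2)) with
      (Rabs (mu - lam) * (B * M * exp (Rabs mu * B + 2))) by ring.
    rewrite (Rmult_comm (B * M * exp ((Rabs lam + 1) * B + 2))).
    apply Rmult_le_compat_l; [apply Rabs_pos|]. apply Rmult_le_compat_l; [exact HBM|].
    apply exp_le_mono. apply Rplus_le_compat_r, Rmult_le_compat_r; [lra|].
    replace mu with (lam + (mu - lam)) at 1 by ring.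
    apply Rle_trans with (1 := Rabs_triang _ _). lra. }
  destruct (solution_dependence p s c B Hp lam mu (shot lam) (shot_slope lam)
    (shot mu) (shot_slope mu) M (shot_solution lam) (shot_solution mu) HM HM0)
    with (x := x) as [H1 H2]; [| | exact Hx |].
  - now rewrite !shot_0.
  - now rewrite !shot_slope_0.
  - split; eapply Rle_trans; eassumption.
Qed.

Lemma shot_continuous_parameter x : I01 x -> forall lam, continuous (fun mu => shot mu x) lam.
Proof.
  intros Hx lam. destruct (shot_lipschitz lam) as [L [_ HL]].
  apply locally_lipschitz_continuous with L. intros mu Hmu. apply HL; assumption.
Qed.

Lemma shot_defect_continuous lam : continuous shot_defect lam.
Proof.
  assert (H1 : I01 1) by (unfold I01; lra).
  pose proof (shot_continuous_parameter 1 H1).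
  assert (forall lam, continuous (fun mu => shot_slope mu 1) lam).
  { intros lam'. destruct (shot_lipschitz lam') as [L [_ HL]].
    apply locally_lipschitz_continuous with L. intros mu Hmu. apply HL; assumption. }
  unfold shot_defect. cont.
Qed.

Lemma shot_strongly_negative :
  exists k0, forall mu, mu <= - k0 ->
    (forall x, 0 < x <= 1 -> 0 < shot mu x) /\ 0 < shot_defect mu.
Proof.
  set (g1 := - cos b / sin b).
  destruct (strongly_negative_parameter (sin a) (- cos a) g1 sin_a_nonneg shot_slope_0_pos)
    as [k0 Hk0].
  exists k0. intros mu Hmu.
  destruct (Hk0 (- mu)) with (y := shot mu) (z := shot_slope mu) as [Hpos Hslope].
  - lra.
  - rewrite Ropp_involutive. apply shot_solution.
  - apply shot_0.
  - apply shot_slope_0.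
  - split; [exact Hpos|]. unfold shot_defect.
    destruct (Req_dec b 0) as [E|Hne].
    + rewrite E, cos_0, sin_0. specialize (Hpos 1). lra.
    + assert (Hsin : 0 < sin b) by (apply sin_gt_0; lra).
      assert (Hg : g1 * shot mu 1 * sin b = - cos b * shot mu 1) by (unfold g1; field; lra).
      nra.
Qed.

Lemma shot_end_slope_nonpos lam :
  (forall x, I01 x -> 0 <= shot lam x) -> shot lam 1 = 0 -> shot_slope lam 1 <= 0.
Proof.
  intros Hnn E. destruct (shot_solution lam) as [Hy [Hz [Hdy _]]].
  apply Rnot_lt_le. intros Hlt.
  destruct (continuous_pos_near _ 1 (Hz 1) Hlt) as [d [Hd Hnear]].
  set (r := Rmax 0 (1 - d / 2)).
  assert (Hr : 0 <= r < 1 /\ 1 - r < d) by (unfold r, Rmax; destruct Rle_dec; lra).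
  destruct (mean_value (shot lam) (shot_slope lam) r 1) as [t [Ht Hmv]]; [lra | exact Hy | |].
  { intros t Ht. apply Hdy; lra. }
  assert (shot_slope lam 1 / 2 < shot_slope lam t).
  { apply Hnear. rewrite Rabs_minus_sym, Rabs_pos_eq; lra. }
  assert (0 <= shot lam r) by (apply Hnn; unfold I01; lra). nra.
Qed.

(** An interior zero of a nonnegative function is a minimum, hence a double
    zero. *)
Lemma shot_pos_of_nonneg lam :
  (forall x, I01 x -> 0 <= shot lam x) -> forall x, 0 < x < 1 -> 0 < shot lam x.
Proof.
  intros Hnn x Hx. assert (HI : I01 x) by (unfold I01; lra).
  destruct (Rle_lt_or_eq_dec _ _ (Hnn x HI)) as [Hlt|E]; [exact Hlt|exfalso].
  pose proof (shot_solution lam) as Hsol.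
  assert (Hs : shot_slope lam x = 0).
  { apply (slope_zero_at_interior_min (shot lam) x); [exact Hx | apply Hsol, Hx |].
    intros t Ht. rewrite <- E. apply Hnn, Ht. }
  destruct (solution_no_double_zero p s c B Hp lam _ _ x Hsol HI) as [H0 H1];
    [now symmetry | exact Hs |].
  rewrite shot_0 in H0. rewrite shot_slope_0 in H1.
  pose proof (shot_slope_0_pos H0). lra.
Qed.

(** If [shot l0] were negative somewhere, lowering the parameter until the
    negative part disappears would leave a function whose last zero escapes
    through the end point 1, where [shot_defect] is then nonpositive; an
    eigenvalue below [l0] would follow. *)
Lemma first_shot_positive l0 :
  (forall mu, mu < l0 -> shot_defect mu <> 0) ->
  forall x, 0 < x < 1 -> 0 < shot l0 x.
Proof.
  intros Hleast. apply shot_pos_of_nonneg.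
  destruct shot_strongly_negative as [k0 Hk0].
  intros x1 Hx1. apply Rnot_lt_le. intros Hneg.
  set (bad := fun mu => mu <= l0 /\ exists x, I01 x /\ shot mu x < 0).
  assert (Hbad0 : bad l0) by (split; [lra | exists x1; auto]).
  assert (Hgood : forall mu, (forall x, 0 < x <= 1 -> 0 < shot mu x) -> ~ bad mu).
  { intros mu Hpos [_ [x [Hx Hlt]]]. destruct (Req_dec x 0) as [E|Hne].
    - rewrite E, shot_0 in Hlt. pose proof sin_a_nonneg. lra.
    - specialize (Hpos x). unfold I01 in Hx. lra. }
  (* completeness is stated for suprema, so the infimum L is minus the supremum of the reflected set *)
  destruct (completeness (fun t => bad (- t))) as [m [Hub Hleast_ub]].
  { exists k0. intros t Ht. apply Rnot_lt_le. intros Hlt.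
    apply (Hgood (- t)); [|exact Ht]. apply Hk0. lra. }
  { exists (- l0). now rewrite Ropp_involutive. }
  set (L := - m).
  assert (HL : forall mu, bad mu -> L <= mu).
  { intros mu Hmu. unfold L. enough (- mu <= m) by lra. apply Hub. now rewrite Ropp_involutive. }
  assert (HLnear : forall d, 0 < d -> exists mu, bad mu /\ L <= mu < L + d).
  { intros d Hd. apply NNPP. intros Hno.
    enough (m <= m - d) by lra. apply Hleast_ub. intros t Ht. apply Rnot_lt_le. intros Hlt.
    apply Hno. exists (- t). split; [exact Ht|]. split; [apply HL, Ht | unfold L; lra]. }
  assert (HLl0 : L <= l0) by (apply HL, Hbad0).
  assert (HLnn : forall x, I01 x -> 0 <= shot L x).
  { intros x Hx. apply Rnot_lt_le. intros Hlt.
    destruct (continuous_pos_near (fun mu => - shot mu x) L) as [d [Hd Hnear]].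
    - apply continuous_Ropp, shot_continuous_parameter, Hx.
    - lra.
    - assert (bad (L - d / 2)) as Hb.
      { split; [lra|]. exists x. split; [exact Hx|].
        specialize (Hnear (L - d / 2)).
        replace (L - d / 2 - L) with (- (d / 2)) in Hnear by ring.
        rewrite Rabs_Ropp, Rabs_pos_eq in Hnear by lra. lra. }
      apply HL in Hb. lra. }
  assert (HLlt : L < l0).
  { destruct (Rle_lt_or_eq_dec _ _ HLl0) as [Hlt|E]; [exact Hlt|].
    rewrite E in HLnn. specialize (HLnn x1 Hx1). lra. }
  assert (HI1 : I01 1) by (unfold I01; lra).
  assert (Hend : shot L 1 = 0).
  { destruct (Rle_lt_or_eq_dec _ _ (HLnn 1 HI1)) as [Hlt|E]; [exfalso | now symmetry].
    destruct (shot_solution L) as [Hy [Hz _]].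
    destruct (positivity_stable (shot L) (shot_slope L) Hy Hz) as [eps [Heps Hst]].
    - rewrite shot_0. apply sin_a_nonneg.
    - rewrite shot_0, shot_slope_0. apply shot_slope_0_pos.
    - intros x Hx. destruct (Req_dec x 1) as [->|Hne]; [exact Hlt|].
      apply shot_pos_of_nonneg; [exact HLnn | lra].
    - destruct (shot_lipschitz L) as [M [HM HMl]].
      set (d := Rmin 1 (eps / (M + 1))).
      assert (Hd : 0 < d).
      { apply Rmin_glb_lt; [lra | apply Rdiv_lt_0_compat; lra]. }
      assert (Hd1 : d <= 1) by apply Rmin_l.
      assert (Hd2 : M * d <= eps).
      { apply Rle_trans with ((M + 1) * (eps / (M + 1))).
        - apply Rmult_le_compat; [lra | lra | lra | apply Rmin_r].
        - right. field. lra. }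
      destruct (HLnear d Hd) as [mu [Hmu [Hm1 Hm2]]].
      apply (Hgood mu); [|exact Hmu].
      destruct (shot_solution mu) as [Hy' [_ [Hdy' _]]].
      apply (Hst (shot mu) (shot_slope mu) Hy' Hdy').
      { now rewrite !shot_0. }
      assert (Habs : Rabs (mu - L) <= d) by (rewrite Rabs_pos_eq; lra).
      intros x Hx. destruct (HMl mu) with (x := x) as [H1 H2]; [lra | exact Hx |].
      assert (M * Rabs (mu - L) <= eps).
      { apply Rle_trans with (2 := Hd2). apply Rmult_le_compat_l; assumption. }
      split; lra. }
  assert (Hdef : shot_defect L <= 0).
  { unfold shot_defect. rewrite Hend. pose proof (shot_end_slope_nonpos L HLnn Hend).
    assert (0 <= sin b) by (apply sin_ge_0; lra). nra. }
  assert (HkL : - k0 < L).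
  { apply Rnot_le_lt. intros Hle. destruct (Hk0 L Hle) as [_ H]. lra. }
  destruct (Hk0 (- k0)) as [_ Hdefk]; [lra|].
  destruct (IVT_gen_consistent shot_defect (- k0) L 0 shot_defect_continuous) as [mu [Hmu Emu]].
  { unfold Rmin, Rmax; destruct Rle_dec; lra. }
  rewrite Rmin_left, Rmax_right in Hmu by lra.
  apply (Hleast mu); [lra | exact Emu].
Qed.

End Shooting.
End GroundState.

(** * From complex eigenfunctions to real solutions and back *)

Lemma within01_proper (x : R) : I01 x -> ProperFilter (within I01 (locally x)).
Proof.
  intros Hx. constructor; [|apply within_filter, locally_filter].
  intros P HP. exists x. apply (locally_singleton _ _ HP), Hx.
Qed.

Lemma within01_lim (x : R) :
  is_filter_lim (T := R_UniformSpace) (within I01 (locally x)) x.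
Proof. intros P HP. apply (filter_le_within (F := locally x) I01), HP. Qed.

Lemma within01_interior (x : R) (P : R -> Prop) :
  0 < x < 1 -> within I01 (locally x) P -> locally x P.
Proof.
  intros Hx HP. generalize (filter_and (F := locally x) _ _ HP (locally_open_interval 0 1 x Hx)).
  apply filter_imp. intros t [H1 H2]. apply H1. unfold I01; lra.
Qed.

Lemma RtoC_linear : is_linear (K := R_AbsRing) (U := R_NormedModule) (V := C_R_NormedModule) RtoC.
Proof.
  apply (is_linear_prod (K := R_AbsRing) (T := R_NormedModule) (U := R_NormedModule)
    (V := R_NormedModule) (fun r : R_NormedModule => r) (fun _ => zero)).
  - apply is_linear_id.
  - apply is_linear_zero.
Qed.

Lemma is_derive01_RtoC (f : R -> R) (x l : R) :
  I01 x -> is_derive f x l -> is_derive01 (fun t => RtoC (f t)) x (RtoC l).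
Proof.
  intros Hx Hd. unfold is_derive01.
  apply (filterdiff_locally (FF := within01_proper x Hx) _ x); [apply within01_lim|].
  apply (filterdiff_ext_lin (K := R_AbsRing) (U := R_NormedModule) (V := C_R_NormedModule)
     _ (fun h : R => RtoC (scal h l))).
  - apply (filterdiff_comp' (K := R_AbsRing) (U := R_NormedModule) (V := R_NormedModule)
      (W := C_R_NormedModule) f RtoC x (fun h => scal h l) RtoC); [exact Hd|].
    apply filterdiff_linear, RtoC_linear.
  - intros h. unfold RtoC, scal; simpl. unfold prod_scal, scal; simpl. unfold mult; simpl.
    f_equal; ring.
Qed.

Lemma continuous01_RtoC (f : R -> R) (x : R) :
  continuous f x -> continuous01 (V := C_UniformSpace) (fun t => RtoC (f t)) x.
Proof.
  intros Hc. unfold continuous01.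
  apply (filterlim_filter_le_1 (F := locally x)); [apply (filter_le_within (F := locally x))|].
  apply (filterlim_comp _ _ _ f RtoC _ (locally (f x))); [exact Hc|].
  apply (linear_cont (K := R_AbsRing) (U := R_NormedModule) (V := C_R_NormedModule)).
  apply RtoC_linear.
Qed.

Lemma continuous01_clamp (u : R -> C) :
  (forall x, I01 x -> continuous01 (V := C_UniformSpace) u x) ->
  forall x, filterlim (fun t => u (clamp t)) (locally x)
              (locally (T := C_UniformSpace) (u (clamp x))).
Proof.
  intros Hu x.
  apply (filterlim_comp _ _ _ clamp u _ (within I01 (locally (clamp x))));
    [|apply Hu, clamp_I01].
  intros P HP. generalize (clamp_continuous x _ HP). unfold filtermap. apply filter_imp.
  intros t Ht. apply Ht, clamp_I01.
Qed.

Lemma is_derive01_continuous01 (u : R -> C) x l :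
  is_derive01 u x l -> continuous01 (V := C_UniformSpace) u x.
Proof.
  intros H.
  apply (filterdiff_continuous_aux (K := R_AbsRing) (U := R_NormedModule)
    (V := C_R_NormedModule) (F := within I01 (locally x)) u); [|apply within01_lim].
  eexists; exact H.
Qed.

(** For a real spectral parameter the equation and the boundary conditions have
    real coefficients, so any real-linear map from the plane to the line that
    respects real factors sends a complex solution to a real one. *)
Definition coordinate (proj : C -> R) : Prop :=
  is_linear (K := R_AbsRing) (U := C_R_NormedModule) (V := R_NormedModule) proj /\
  (forall z, proj (- z)%C = - proj z) /\
  (forall r z, proj (RtoC r * z)%C = r * proj z) /\
  (forall z w, proj (z + w)%C = proj z + proj w).

Lemma coordinate_Re : coordinate Re.
Proof.
  split; [|split; [|split]].
  - apply (is_linear_fst (K := R_AbsRing) (U := R_NormedModule) (V := R_NormedModule)).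
  - reflexivity.
  - intros r z. unfold Re, Im, Cmult, RtoC. simpl. ring.
  - reflexivity.
Qed.

Lemma coordinate_Im : coordinate Im.
Proof.
  split; [|split; [|split]].
  - apply (is_linear_snd (K := R_AbsRing) (U := R_NormedModule) (V := R_NormedModule)).
  - reflexivity.
  - intros r z. unfold Re, Im, Cmult, RtoC. simpl. ring.
  - reflexivity.
Qed.

Lemma is_derive01_coordinate (proj : C -> R) (u : R -> C) (x : R) (l : C) :
  coordinate proj -> 0 < x < 1 -> is_derive01 u x l ->
  is_derive (fun t => proj (u (clamp t))) x (proj l).
Proof.
  intros [Hlin _] Hx Hd.
  apply (is_derive_ext_loc (K := R_AbsRing) (V := R_NormedModule) (fun t => proj (u t))).
  { generalize (locally_open_interval 0 1 x Hx). apply filter_imp. intros t Ht.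
    rewrite clamp_id by (unfold I01; lra). reflexivity. }
  assert (Hdw : filterdiff (K := R_AbsRing) (U := R_NormedModule) (V := R_NormedModule)
     (fun t => proj (u t)) (within I01 (locally x)) (fun h => proj (scal h l))).
  { apply (filterdiff_comp (K := R_AbsRing) (U := R_NormedModule) (V := C_R_NormedModule)
      (W := R_NormedModule) u proj (fun h => scal h l) proj Hd).
    apply filterdiff_linear, Hlin. }
  apply (filterdiff_ext_lin (K := R_AbsRing) (U := R_NormedModule) (V := R_NormedModule)
     _ (fun h : R => proj (scal h l))).
  - destruct Hdw as [Hl Hdw]. split; [exact Hl|].
    intros t Ht eps. apply within01_interior; [exact Hx|]. apply Hdw.
    intros P HP. apply (filter_le_within (F := locally x) I01), Ht, HP.
  - intros h. apply (linear_scal (K := R_AbsRing) (U := C_R_NormedModule)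
      (V := R_NormedModule) proj Hlin).
Qed.

Lemma continuous_coordinate (proj : C -> R) (u : R -> C) :
  coordinate proj ->
  (forall x, I01 x -> continuous01 (V := C_UniformSpace) u x) ->
  forall x, continuous (fun t => proj (u (clamp t))) x.
Proof.
  intros [Hlin _] Hu x.
  apply (filterlim_comp _ _ _ (fun t => u (clamp t)) proj _
    (locally (T := C_UniformSpace) (u (clamp x)))); [apply continuous01_clamp, Hu|].
  apply (linear_cont (K := R_AbsRing) (U := C_R_NormedModule) (V := R_NormedModule)), Hlin.
Qed.

Section Bridge.
Context (p : R -> R) (s : list R) (c B : R) (Hp : weight p s c B).
Context (a b : R) (ha : 0 < a <= PI) (hb : 0 <= b < PI).

Lemma eigenvalue_of_root mu : shot_defect p a b mu = 0 -> eigenvalue p a b (RtoC mu).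
Proof.
  intros Hroot. pose proof (shot_solution p s c B Hp a mu) as Hsol.
  exists (fun x => RtoC (shot p a mu x)). split.
  - exists (fun x => RtoC (shot_slope p a mu x)).
    split; [|split; [|split; [|split]]].
    + intros x Hx. apply is_derive01_RtoC; [exact Hx|].
      apply (ivp_value_is_derive p s c B Hp).
    + intros x _. apply continuous01_RtoC, Hsol.
    + intros x Hx Hc. exists (RtoC (- (mu * p x * shot p a mu x))). split.
      * apply is_derive01_RtoC; [unfold I01; lra|].
        apply Hsol; [exact Hx | apply continuous01_interior; assumption].
      * rewrite <- RtoC_opp, <- !RtoC_mult. f_equal. ring.
    + rewrite (shot_0 p s c B Hp), (shot_slope_0 p s c B Hp), <- !RtoC_mult, <- RtoC_plus.
      f_equal. ring.
    + rewrite <- !RtoC_mult, <- RtoC_plus. f_equal. exact Hroot.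
  - apply NNPP. intros Hno.
    assert (Hz : forall x, I01 x -> shot p a mu x = 0).
    { intros x Hx. apply NNPP. intros Hne. apply Hno. exists x. split; [exact Hx|].
      intros E. apply Hne, RtoC_inj, E. }
    assert (Hhalf : 0 < / 2 < 1) by lra.
    assert (HI : I01 (/ 2)) by (unfold I01; lra).
    destruct (solution_no_double_zero p s c B Hp mu _ _ (/ 2) Hsol HI (Hz _ HI)) as [H0 H1].
    { apply (slope_zero_at_interior_min (shot p a mu) (/ 2)); [exact Hhalf | apply Hsol, Hhalf |].
      intros t Ht. rewrite !Hz by assumption. lra. }
    rewrite (shot_0 p s c B Hp) in H0. rewrite (shot_slope_0 p s c B Hp) in H1.
    pose proof (shot_slope_0_pos a ha H0). lra.
Qed.

Lemma solution_scal lam k y z :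
  solution p lam y z -> solution p lam (fun x => k * y x) (fun x => k * z x).
Proof.
  intros [Hy [Hz [Hdy Hdz]]]. split; [|split; [|split]].
  - intros x. cont.
  - intros x. cont.
  - intros x Hx. apply is_derive_scal, Hdy, Hx.
  - intros x Hx Hc. replace (- (lam * p x * (k * y x))) with (k * - (lam * p x * y x)) by ring.
    apply is_derive_scal, Hdz; assumption.
Qed.

(** The boundary condition at 0 makes the initial data orthogonal to
    [(cos a, sin a)], hence proportional to those of [shot]. *)
Lemma solution_multiple_of_shot lam y z :
  solution p lam y z -> y 0 * cos a + z 0 * sin a = 0 ->
  exists k, forall x, I01 x -> y x = k * shot p a lam x /\ z x = k * shot_slope p a lam x.
Proof.
  intros Hsol Hbc. exists (y 0 * sin a - z 0 * cos a).
  pose proof (sin2_cos2 a) as Htrig. unfold Rsqr in Htrig.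
  apply (solution_unique p s c B Hp lam (fun x => _ * shot p a lam x)
    (fun x => _ * shot_slope p a lam x)); [| exact Hsol | |].
  - apply solution_scal, (shot_solution p s c B Hp).
  - rewrite (shot_0 p s c B Hp).
    replace ((y 0 * sin a - z 0 * cos a) * sin a) with
      (y 0 * (sin a * sin a + cos a * cos a) - cos a * (y 0 * cos a + z 0 * sin a)) by ring.
    rewrite Htrig, Hbc. ring.
  - rewrite (shot_slope_0 p s c B Hp).
    replace ((y 0 * sin a - z 0 * cos a) * - cos a) with
      (z 0 * (sin a * sin a + cos a * cos a) - sin a * (y 0 * cos a + z 0 * sin a)) by ring.
    rewrite Htrig, Hbc. ring.
Qed.

Lemma bvp_solution_coordinate (proj : C -> R) lam (u : R -> C) :
  coordinate proj -> bvp_solution p a b (RtoC lam) u ->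
  exists k, (forall x, I01 x -> proj (u x) = k * shot p a lam x) /\
            k * shot_defect p a b lam = 0.
Proof.
  intros Hproj [du [Hu [Hdu [Heq [Hbc0 Hbc1]]]]].
  pose proof Hproj as [_ [Hopp [Hmul Hadd]]].
  assert (Hp0 : proj (RtoC 0) = 0).
  { pose proof (Hmul 0 (RtoC 0)) as H. rewrite Cmult_0_l, Rmult_0_l in H. exact H. }
  assert (Hcl : forall x, I01 x -> clamp x = x) by exact clamp_id.
  assert (H0 : I01 0) by (unfold I01; lra). assert (H1 : I01 1) by (unfold I01; lra).
  destruct (solution_multiple_of_shot lam (fun t => proj (u (clamp t)))
    (fun t => proj (du (clamp t)))) as [k Hk].
  - split; [|split; [|split]].
    + apply continuous_coordinate; [exact Hproj|]. intros x Hx.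
      eapply is_derive01_continuous01, Hu, Hx.
    + apply continuous_coordinate; [exact Hproj | exact Hdu].
    + intros x Hx. rewrite (Hcl x) by (unfold I01; lra).
      apply is_derive01_coordinate; [exact Hproj | exact Hx |].
      apply Hu. unfold I01; lra.
    + intros x Hx Hc.
      destruct (Heq x Hx) as [d2u [Hd2 E]]; [apply continuous01_interior; assumption|].
      rewrite (Hcl x) by (unfold I01; lra).
      replace (- (lam * p x * proj (u x))) with (proj d2u).
      { apply is_derive01_coordinate; assumption. }
      apply (f_equal proj) in E. rewrite <- RtoC_mult, Hopp, Hmul in E. lra.
  - rewrite !Hcl by assumption.
    apply (f_equal proj) in Hbc0.
    rewrite Hadd, !(Cmult_comm _ (RtoC _)), !Hmul, Hp0 in Hbc0. lra.
  - exists k. split.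
    + intros x Hx. rewrite <- (proj1 (Hk x Hx)), Hcl by exact Hx. reflexivity.
    + destruct (Hk 1 H1) as [E1 E2]. rewrite (Hcl 1 H1) in E1, E2.
      apply (f_equal proj) in Hbc1.
      rewrite Hadd, !(Cmult_comm _ (RtoC _)), !Hmul, Hp0, E1, E2 in Hbc1.
      unfold shot_defect. lra.
Qed.

Lemma root_of_eigenvalue lam : eigenvalue p a b (RtoC lam) -> shot_defect p a b lam = 0.
Proof.
  intros [u [Hu [x [Hx Hne]]]].
  destruct (bvp_solution_coordinate Re lam u coordinate_Re Hu) as [k1 [Hk1 E1]].
  destruct (bvp_solution_coordinate Im lam u coordinate_Im Hu) as [k2 [Hk2 E2]].
  destruct (Req_dec k1 0) as [Z1|N1]; [destruct (Req_dec k2 0) as [Z2|N2]|].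
  - exfalso. apply Hne.
    specialize (Hk1 x Hx). specialize (Hk2 x Hx). rewrite Z1, Rmult_0_l in Hk1.
    rewrite Z2, Rmult_0_l in Hk2.
    rewrite (surjective_pairing (u x)). unfold RtoC. f_equal; assumption.
  - apply Rmult_integral in E2. tauto.
  - apply Rmult_integral in E1. tauto.
Qed.

Lemma lowest_eigenvalue_shot l0 :
  lowest_eigenvalue p a b l0 ->
  shot_defect p a b l0 = 0 /\ forall x, 0 < x < 1 -> 0 < shot p a l0 x.
Proof.
  intros [Hev Hmin]. split; [apply root_of_eigenvalue, Hev|].
  apply (first_shot_positive p s c B Hp a b ha hb). intros mu Hmu E.
  pose proof (Hmin mu (eigenvalue_of_root mu E)). lra.
Qed.

(** For the eigenvalue 0 the eigenfunction is [sin a - cos a * x]. Positivity on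
    the open interval forces [cos a <= sin a], that is [PI / 4 <= a], and the
    boundary condition at 1 then forces [b <= 3 * PI / 4]. In that range the
    boundary condition is the equation excluded by hypothesis. *)
Lemma lowest_eigenvalue_nonzero l0 :
  (PI / 4 <= a <= PI -> 0 <= b <= 3 * PI / 4 -> cos a * cos b - sin (a - b) <> 0) ->
  lowest_eigenvalue p a b l0 -> l0 <> 0.
Proof.
  intros hab Hl E. rewrite E in Hl. destruct (lowest_eigenvalue_shot 0 Hl) as [Hdef Hpos].
  assert (Hlin : forall x, I01 x ->
     shot p a 0 x = sin a - cos a * x /\ shot_slope p a 0 x = - cos a).
  { apply (solution_unique p s c B Hp 0 (fun x => sin a - cos a * x) (fun _ => - cos a)).
    - split; [|split; [|split]].
      + intros x. cont.
      + intros x. cont.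
      + intros x _. auto_derive; [exact I | ring].
      + intros x _ _. replace (- (0 * p x * (sin a - cos a * x))) with 0 by ring.
        apply (is_derive_const (K := R_AbsRing) (V := R_NormedModule)).
    - apply (shot_solution p s c B Hp).
    - rewrite (shot_0 p s c B Hp). ring.
    - rewrite (shot_slope_0 p s c B Hp). ring. }
  assert (H1 : I01 1) by (unfold I01; lra).
  unfold shot_defect in Hdef. rewrite (proj1 (Hlin 1 H1)), (proj2 (Hlin 1 H1)) in Hdef.
  pose proof (sin_a_nonneg a ha) as Hsa.
  pose proof PI_RGT_0 as HPI.
  assert (Hsqrt : 0 < / sqrt 2) by (apply Rinv_0_lt_compat, sqrt_lt_R0; lra).
  assert (Hend : cos a <= sin a).
  { apply Rnot_lt_le. intros Hlt.
    (* the midpoint between 1 and tan a, the zero of the linear function *)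
    set (x := (1 + sin a / cos a) / 2).
    assert (Hq : sin a / cos a * cos a = sin a) by (field; lra).
    assert (Hx : 0 < x < 1).
    { assert (0 <= sin a / cos a) by (apply Rdiv_le_0_compat; lra).
      assert (sin a / cos a < 1) by nra. unfold x. lra. }
    specialize (Hpos x Hx).
    rewrite (proj1 (Hlin x ltac:(unfold I01; lra))) in Hpos.
    replace (cos a * x) with ((cos a + sin a) / 2) in Hpos by (unfold x; field; lra). lra. }
  assert (Ha4 : PI / 4 <= a).
  { apply Rnot_lt_le. intros Hlt.
    assert (Hs : 0 < sin (PI / 4 - a)) by (apply sin_gt_0; lra).
    rewrite sin_minus, sin_PI4, cos_PI4 in Hs. unfold Rdiv in Hs. nra. }
  assert (Hb4 : b <= 3 * PI / 4).
  { apply Rnot_lt_le. intros Hlt.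
    assert (Hs : sin (b + PI / 4) < 0) by (apply sin_lt_0; lra).
    rewrite sin_plus, sin_PI4, cos_PI4 in Hs.
    assert (Hsum : sin b + cos b < 0) by (unfold Rdiv in Hs; nra).
    assert (Hsb : 0 < sin b) by (apply sin_gt_0; lra).
    assert (Hca : cos a <= 0) by nra.
    assert (Hprod : 0 <= sin a * cos b) by nra.
    assert (Hsa0 : sin a = 0) by nra.
    pose proof (shot_slope_0_pos a ha Hsa0). nra. }
  apply hab; [lra | lra |]. rewrite sin_minus. lra.
Qed.
End Bridge.

(** * Equality in the eigenvalue comparison *)

Lemma max01_upper (f : R -> R) (M : R) :
  (forall x, I01 x -> f x <= M) -> forall x, I01 x -> f x <= max01 f.
Proof.
  intros HM x Hx. unfold max01.
  destruct (Lub_Rbar_correct (fun y => exists x, I01 x /\ y = f x)) as [Hub Hleast].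
  assert (H1 : Rbar_le (f x) (Lub_Rbar (fun y => exists x, I01 x /\ y = f x))).
  { apply Hub. exists x; auto. }
  assert (H2 : Rbar_le (Lub_Rbar (fun y => exists x, I01 x /\ y = f x)) M).
  { apply Hleast. intros y [t [Ht ->]]. apply HM, Ht. }
  destruct (Lub_Rbar _); simpl in *; tauto.
Qed.

Lemma min01_lower (f : R -> R) (m : R) :
  (forall x, I01 x -> m <= f x) -> forall x, I01 x -> min01 f <= f x.
Proof.
  intros Hm x Hx. unfold min01.
  destruct (Glb_Rbar_correct (fun y => exists x, I01 x /\ y = f x)) as [Hlb Hgreatest].
  assert (H1 : Rbar_le (Glb_Rbar (fun y => exists x, I01 x /\ y = f x)) (f x)).
  { apply Hlb. exists x; auto. }
  assert (H2 : Rbar_le m (Glb_Rbar (fun y => exists x, I01 x /\ y = f x))).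
  { apply Hgreatest. intros y [t [Ht ->]]. apply Hm, Ht. }
  destruct (Glb_Rbar _); simpl in *; tauto.
Qed.

Lemma exists_not_in (s : list R) : forall u v : R, u < v -> exists t, u < t < v /\ ~ In t s.
Proof.
  induction s as [|c s IH]; intros u v Huv.
  - exists ((u + v) / 2). split; [lra | auto].
  - assert (Hsub : forall v', u < v' <= v -> ~ u < c < v' ->
      exists t, u < t < v /\ ~ In t (c :: s)).
    { intros v' Hv' Hc. destruct (IH u v') as [t [Ht Hns]]; [lra|].
      exists t. split; [lra|]. intros [->|Hin]; [lra | auto]. }
    destruct (Rlt_dec u c); [destruct (Rlt_dec c v)|].
    + apply (Hsub c); lra.
    + apply (Hsub v); lra.
    + apply (Hsub v); lra.
Qed.

(** Continuity is needed only at the point in question, including the end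
    points, because the points outside a finite set are dense. *)
Lemma continuous01_zero (s : list R) (r : R -> R) :
  (forall x, 0 < x < 1 -> ~ In x s -> r x = 0) ->
  forall x, I01 x -> continuous01 r x -> r x = 0.
Proof.
  intros Hz x Hx Hc. apply NNPP. intros Hne.
  assert (He : 0 < Rabs (r x)) by (apply Rabs_pos_lt, Hne).
  destruct (proj1 (filterlim_locally _ _) Hc (mkposreal _ He)) as [d Hd].
  pose proof (cond_pos d). unfold I01 in Hx.
  destruct (exists_not_in s (Rmax 0 (x - d)) (Rmin 1 (x + d))) as [t [Ht Hns]].
  { unfold Rmax, Rmin; repeat destruct Rle_dec; lra. }
  pose proof (Rmax_l 0 (x - d)). pose proof (Rmax_r 0 (x - d)).
  pose proof (Rmin_l 1 (x + d)). pose proof (Rmin_r 1 (x + d)).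
  assert (Hball : Rabs (r t - r x) < Rabs (r x)).
  { apply Hd; [|unfold I01; lra]. change (Rabs (t - x) < d). apply Rabs_def1; lra. }
  rewrite (Hz t) in Hball by (auto; lra).
  rewrite Rminus_0_l, Rabs_Ropp in Hball. lra.
Qed.

Lemma derivative_zero_of_equal_ends (s : list R) (f df : R -> R) :
  (forall x, continuous f x) ->
  (forall x, 0 < x < 1 -> ~ In x s -> is_derive f x (df x) /\ 0 <= df x) ->
  f 0 = f 1 ->
  forall x, 0 < x < 1 -> ~ In x s -> df x = 0.
Proof.
  intros Hc Hd E x Hx Hns.
  apply (slope_zero_at_interior_min f x); [exact Hx | apply Hd; assumption |].
  intros t Ht. unfold I01 in Ht.
  assert (f 0 <= f t).
  { apply (nondecreasing_off_finite s f df Hc); [lra|]. intros y Hy. apply Hd; lra. }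
  assert (f x <= f 1).
  { apply (nondecreasing_off_finite s f df Hc); [lra|]. intros y Hy. apply Hd; lra. }
  lra.
Qed.

Theorem theorem2p1 (a b : R) (ha : 0 < a <= PI) (hb : 0 <= b < PI)
  (hab : PI / 4 <= a <= PI -> 0 <= b <= 3 * PI / 4 ->
         cos a * cos b - sin (a - b) <> 0)
  (p pt : R -> R) (hp : density p) (hpt : density pt)
  (l0 lt0 : R)
  (hl0 : lowest_eigenvalue p a b l0) (hlt0 : lowest_eigenvalue pt a b lt0)
  (hmaxmin : l0 = lt0 * max01 (fun x => pt x / p x) \/
             l0 = lt0 * min01 (fun x => pt x / p x)) :
  forall x, I01 x -> continuous01 p x -> continuous01 pt x ->
    p x = lt0 / l0 * pt x.
Proof.
  destruct (density_weight p hp) as [s [c [B Hp]]].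
  destruct (density_weight pt hpt) as [st [ct [Bt Hpt]]].
  pose proof (lowest_eigenvalue_nonzero p s c B Hp a b ha hb l0 hab hl0) as Hl0.
  destruct (lowest_eigenvalue_shot p s c B Hp a b ha hb l0 hl0) as [Hdef Hpos].
  destruct (lowest_eigenvalue_shot pt st ct Bt Hpt a b ha hb lt0 hlt0) as [Hdeft Hpost].
  set (r := fun x => l0 * p x + - lt0 * pt x).
  assert (Hppos : forall x, I01 x -> 0 < p x) by apply hp.
  assert (Hsign : exists sg, sg <> 0 /\ forall x, I01 x -> 0 <= sg * r x).
  { assert (Hfac : forall M, l0 = lt0 * M -> forall x, I01 x ->
       r x = lt0 * p x * (M - pt x / p x)).
    { intros M E x Hx. unfold r. rewrite E. field. specialize (Hppos x Hx). lra. }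
    assert (Hrange : forall x, I01 x -> 0 <= pt x / p x <= Bt / c).
    { intros x Hx. pose proof (Hppos x Hx). pose proof (weight_pos pt st ct Bt Hpt x Hx).
      destruct Hp as [Hc [Hpb _]]. destruct Hpt as [_ [Hptb _]].
      specialize (Hpb x Hx). specialize (Hptb x Hx). split.
      - apply Rdiv_le_0_compat; lra.
      - apply Rmult_le_compat; [lra | left; apply Rinv_0_lt_compat; lra | lra |].
        apply Rinv_le_contravar; lra. }
    assert (Hlt0 : lt0 <> 0).
    { intros E. apply Hl0. destruct hmaxmin as [H|H]; rewrite H, E; ring. }
    destruct hmaxmin as [E|E]; [exists lt0 | exists (- lt0)].
    - split; [exact Hlt0|]. intros x Hx. rewrite (Hfac _ E x Hx).
      pose proof (max01_upper _ (Bt / c) (fun t Ht => proj2 (Hrange t Ht)) x Hx) as HM.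
      pose proof (Hppos x Hx). simpl in HM.
      rewrite <- !Rmult_assoc. apply Rmult_le_pos; [|lra].
      apply Rmult_le_pos; [apply Rle_0_sqr | lra].
    - split; [lra|]. intros x Hx. rewrite (Hfac _ E x Hx).
      pose proof (min01_lower _ 0 (fun t Ht => proj1 (Hrange t Ht)) x Hx) as Hm.
      pose proof (Hppos x Hx). simpl in Hm.
      replace (- lt0 * (lt0 * p x * (min01 (fun x => pt x / p x) - pt x / p x))) with
        (lt0 * lt0 * p x * (pt x / p x - min01 (fun x => pt x / p x))) by ring.
      apply Rmult_le_pos; [|lra]. apply Rmult_le_pos; [apply Rle_0_sqr | lra]. }
  destruct Hsign as [sg [Hsg Hsign]].
  set (y := shot p a l0) in *. set (z := shot_slope p a l0).
  set (yt := shot pt a lt0) in *. set (zt := shot_slope pt a lt0).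
  destruct (shot_solution p s c B Hp a l0) as [Hy [Hz [Hdy Hdz]]].
  destruct (shot_solution pt st ct Bt Hpt a lt0) as [Hyt [Hzt [Hdyt Hdzt]]].
  fold y z in Hy, Hz, Hdy, Hdz. fold yt zt in Hyt, Hzt, Hdyt, Hdzt.
  assert (Hinit : y 0 = sin a /\ z 0 = - cos a /\ yt 0 = sin a /\ zt 0 = - cos a).
  { unfold y, z, yt, zt.
    rewrite (shot_0 p s c B Hp), (shot_slope_0 p s c B Hp),
      (shot_0 pt st ct Bt Hpt), (shot_slope_0 pt st ct Bt Hpt). auto. }
  unfold shot_defect in Hdef, Hdeft. fold y z in Hdef. fold yt zt in Hdeft.
  clearbody y z yt zt.
  set (W := fun x => sg * (y x * zt x - z x * yt x)).
  assert (HW1 : y 1 * zt 1 - z 1 * yt 1 = 0).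
  { pose proof (sin2_cos2 b) as Htrig. unfold Rsqr in Htrig.
    set (w := y 1 * zt 1 - z 1 * yt 1).
    assert (Hcos : w * cos b = 0).
    { replace (w * cos b) with (zt 1 * (y 1 * cos b + z 1 * sin b) -
        z 1 * (yt 1 * cos b + zt 1 * sin b)) by (unfold w; ring).
      rewrite Hdef, Hdeft. ring. }
    assert (Hsin : w * sin b = 0).
    { replace (w * sin b) with (y 1 * (yt 1 * cos b + zt 1 * sin b) -
        yt 1 * (y 1 * cos b + z 1 * sin b)) by (unfold w; ring).
      rewrite Hdef, Hdeft. ring. }
    replace w with (w * sin b * sin b + w * cos b * cos b)
      by (rewrite <- (Rmult_1_r w) at 3; rewrite <- Htrig; ring).
    rewrite Hcos, Hsin. ring. }
  assert (Hr : forall x, 0 < x < 1 -> ~ In x (s ++ st) -> r x = 0).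
  { intros x Hx Hns.
    assert (HW : sg * (r x * (y x * yt x)) = 0).
    { apply (derivative_zero_of_equal_ends (s ++ st) W (fun x => sg * (r x * (y x * yt x))));
        [| | | exact Hx | exact Hns].
      - intros t. unfold W. cont.
      - intros t Ht Hnst.
        assert (HI : I01 t) by (unfold I01; lra).
        assert (Hc1 : continuous p t).
        { apply Hp; [exact Ht|]. intros Hin. apply Hnst, in_or_app. now left. }
        assert (Hc2 : continuous pt t).
        { apply Hpt; [exact Ht|]. intros Hin. apply Hnst, in_or_app. now right. }
        pose proof (Hdy t Ht). pose proof (Hdz t Ht Hc1).
        pose proof (Hdyt t Ht). pose proof (Hdzt t Ht Hc2). split.
        + unfold W, r. derive_by_known. ring.
        + rewrite <- Rmult_assoc. apply Rmult_le_pos; [apply Hsign, HI|].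
          apply Rmult_le_pos; left; [apply Hpos | apply Hpost]; exact Ht.
      - unfold W. destruct Hinit as [-> [-> [-> ->]]]. rewrite HW1. ring. }
    pose proof (Rmult_lt_0_compat _ _ (Hpos x Hx) (Hpost x Hx)).
    apply Rmult_integral in HW. destruct HW as [HW|HW]; [contradiction|].
    apply Rmult_integral in HW. destruct HW as [HW|HW]; [exact HW | lra]. }
  intros x Hx Hcp Hcpt.
  assert (Hrx : r x = 0).
  { apply (continuous01_zero (s ++ st) r Hr x Hx). unfold continuous01, r.
    assert (Hsc : forall (k : R) (f : R -> R), continuous01 f x ->
      filterlim (fun t => k * f t) (within I01 (locally x)) (locally (k * f x))).
    { intros k f Hf. apply (filterlim_comp _ _ _ f (Rmult k) _ (locally (f x)) _ Hf).
      apply (filterlim_scal_r (K := R_AbsRing) (V := R_NormedModule) k). }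
    apply (filterlim_comp_2 (G := locally (l0 * p x)) (H := locally (- lt0 * pt x))
      (fun t => l0 * p t) (fun t => - lt0 * pt t) Rplus);
      [apply Hsc, Hcp | apply Hsc, Hcpt |].
    apply (filterlim_plus (K := R_AbsRing) (V := R_NormedModule)). }
  unfold r in Hrx. replace (p x) with (l0 * p x / l0) by (field; exact Hl0).
  replace (l0 * p x) with (lt0 * pt x) by lra. field. exact Hl0.
Qed.
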